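(* Let $(z_l,z_r)\in\mathbb S^3\times\mathbb S^3$. There is a homeomorphism between the space $\mathcal{L}\mathbb S^3(z_l,z_r)$ and the space of pairs of curves $(\gamma_l,\gamma_r)\in\mathcal{L}\mathbb S^2(z_l)\times\mathcal{G}\mathbb S^2(z_r)$ satisfying the condition $$\|\gamma_l'(t)\|=\|\gamma_r'(t)\|,\qquad \kappa_{\gamma_l}(t)>|\kappa_{\gamma_r}(t)|,\qquad t\in[0,1].$$
   Context: Curves are smooth; spaces of curves carry the $C^\infty$ topology, and spaces of pairs the subspace topology of the product. For $n\in\{2,3\}$, a curve $\gamma:[0,1]\to\mathbb S^n\subset\mathbb R^{n+1}$ is generic if $\gamma(t),\gamma'(t),\dots,\gamma^{(n-1)}(t)$ are linearly independent for all $t\in[0,1]$, and locally convex if $\det(\gamma(t),\gamma'(t),\dots,\gamma^{(n)}(t))>0$ for all $t\in[0,1]$. The Frenet frame curve $\mathcal F_\gamma:[0,1]\to\mathrm{SO}_{n+1}$ of a generic curve has as first $n$ columns the result of applying Gram-Schmidt to $(\gamma(t),\dots,\gamma^{(n-1)}(t))$ and as last column the unique vector completing them to a positive orthonormal basis. (Locally convex curves are generic.) Let $\mathbb H$ be the quaternions. Identify $\mathbb R^4$ with $\mathbb H$ (basis $e_1,\dots,e_4\leftrightarrow 1,\mathbf i,\mathbf j,\mathbf k$), $\mathbb R^3$ with the imaginary quaternions (basis $e_1,e_2,e_3\leftrightarrow\mathbf i,\mathbf j,\mathbf k$), and $\mathbb S^3$ with the unit quaternions, with unit $\mathbf 1$.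 Then $\mathrm{Spin}_3=\mathbb S^3$ with double cover $\Pi_3:\mathbb S^3\to\mathrm{SO}_3$, $\Pi_3(z)(h)=zh\bar z$, and $\mathrm{Spin}_4=\mathbb S^3\times\mathbb S^3$ with double cover $\Pi_4:\mathbb S^3\times\mathbb S^3\to\mathrm{SO}_4$, $\Pi_4(z_l,z_r)(q)=z_lq\bar z_r$. If $\mathcal F_\gamma(0)=I$, $\tilde{\mathcal F}_\gamma$ denotes the unique continuous lift of $\mathcal F_\gamma$ to $\mathrm{Spin}_{n+1}$ starting at the identity. For $z\in\mathrm{Spin}_{n+1}$, $\mathcal{G}\mathbb S^n(z)$ (respectively $\mathcal{L}\mathbb S^n(z)$) is the space of generic (respectively locally convex) curves $\gamma:[0,1]\to\mathbb S^n$ with $\mathcal F_\gamma(0)=I$ and $\tilde{\mathcal F}_\gamma(1)=z$; for $n=3$ and $z=(z_l,z_r)$ one writes $\mathcal{L}\mathbb S^3(z_l,z_r)$. For a generic curve $\gamma$ in $\mathbb S^2$ (i.e. an immersion), $\mathbf t_\gamma=\gamma'/\|\gamma'\|$, $\mathbf n_\gamma=\gamma\times\mathbf t_\gamma$ (cross product in $\mathbb R^3$), and the geodesic curvature is $\kappa_\gamma(t)=\dfrac{\mathbf t_\gamma'(t)\cdot\mathbf n_\gamma(t)}{\|\gamma'(t)\|}$. *)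

(* Defs.v *)
From HB Require Import structures.
From mathcomp Require Import all_boot all_order all_algebra.
From mathcomp Require Import all_classical all_reals all_analysis.

Set Implicit Arguments.
Unset Strict Implicit.
Unset Printing Implicit Defensive.

Import Order.TTheory GRing.Theory Num.Theory.
Import numFieldNormedType.Exports.
Local Open Scope classical_set_scope.
Local Open Scope ring_scope.

Definition homeomorphic (X Y : topologicalType) : Prop :=
  exists (f : X -> Y) (g : Y -> X),
    [/\ continuous f, continuous g, cancel f g & cancel g f].

Section EuclideanSpace.
Context {R : realType}.

Definition dot n (u v : 'cV[R]_n) : R := (u^T *m v) 0 0.

(* Needed because the library norm `|u| on 'cV[R]_n is the sup norm. *)
Definition enorm n (u : 'cV[R]_n) : R := Num.sqrt (dot u u).

(* The indices i + 1 and i + 2 are taken modulo 3. *)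
Definition cross (u v : 'cV[R]_3) : 'cV[R]_3 :=
  \col_i (u (i + 1) 0 * v (i + 2) 0 - u (i + 2) 0 * v (i + 1) 0).

Definition gram_schmidt n (vs : seq 'cV[R]_n) : seq 'cV[R]_n :=
  foldl (fun es v =>
           let w := v - \sum_(e <- es) dot v e *: e in
           rcons es ((enorm w)^-1 *: w)) [::] vs.

Definition SO n : set 'M[R]_n := [set A | A^T *m A = 1%:M /\ \det A = 1].

End EuclideanSpace.
Arguments SO : clear implicits.

Section Quaternions.
Context {R : realType}.

(* A quaternion a + b i + c j + d k is the column (a, b, c, d), split into   *)
(* its real part a and its imaginary part (b, c, d).                         *)
Local Notation quat := 'cV[R]_(1 + 3).

Definition qre (q : quat) : R := usubmx q 0 0.
Definition qim (q : quat) : 'cV[R]_3 := dsubmx q.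
Definition Quat (a : R) (u : 'cV[R]_3) : quat := col_mx a%:M u.

Definition qmul (p q : quat) : quat :=
  Quat (qre p * qre q - dot (qim p) (qim q))
       (qre p *: qim q + qre q *: qim p + cross (qim p) (qim q)).

Definition qconj (q : quat) : quat :=
  Quat (qre q) (- qim q).

End Quaternions.

Section Spin.
Context (R : realType).

Definition S3 : set 'cV[R]_(1 + 3) := [set q | enorm q = 1].

Lemma S3_one : Quat 1 0 \in S3.
Proof.
rewrite inE /S3 /= /enorm /dot /Quat tr_col_mx mul_row_col trmx0 mul0mx addr0.
by rewrite tr_scalar_mx -scalar_mxM mulr1 mxE eqxx mulr1n sqrtr1.
Qed.

Definition spin3 : topologicalType := S3.
Definition spin4 : topologicalType := (spin3 * spin3)%type.

Definition one3 : spin3 := SigSub S3_one.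
Definition one4 : spin4 := (one3, one3).

(* The matrices, in the standard bases, of h |-> z h z^* on the imaginary    *)
(* quaternions and of q |-> z_l q z_r^* on all quaternions.                  *)
Definition Pi3 (z : spin3) : 'M[R]_3 :=
  \matrix_(i, j)
    qim (qmul (qmul (\val z) (Quat 0 (delta_mx j 0))) (qconj (\val z))) i 0.

Definition Pi4 (z : spin4) : 'M[R]_4 :=
  \matrix_(i, j)
    qmul (qmul (\val z.1) (delta_mx j 0)) (qconj (\val z.2)) i 0.

End Spin.

Section Curves.
Context {R : realType}.

Definition I01 : topologicalType := `[0 : R, 1]%classic.

Lemma I01_0 : 0 \in `[0 : R, 1]%classic.
Proof. by rewrite inE /= in_itv /= lexx ler01. Qed.

Lemma I01_1 : 1 \in `[0 : R, 1]%classic.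
Proof. by rewrite inE /= in_itv /= lexx ler01. Qed.

Definition I01_start : I01 := SigSub I01_0.
Definition I01_end : I01 := SigSub I01_1.

Context {n : nat}.
Implicit Types (f : I01 -> 'cV[R]_n.+1) (t : I01).

(* t^' is the punctured neighborhood filter of t in [0, 1], so derivatives   *)
(* at the endpoints are one-sided.                                           *)
Definition diff_quot f t : I01 -> 'cV[R]_n.+1 :=
  fun s => (\val s - \val t)^-1 *: (f s - f t).

Definition cderiv f : I01 -> 'cV[R]_n.+1 := fun t => lim (diff_quot f t @ t^').

Definition cderivn k f : I01 -> 'cV[R]_n.+1 := iter k cderiv f.

Definition smooth f : Prop :=
  forall k t, cvg (diff_quot (cderivn k f) t @ t^').

End Curves.
Arguments I01 : clear implicits.
Arguments I01_start : clear implicits.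
Arguments I01_end : clear implicits.

Section CurveSpaces.
Context (R : realType) (n : nat).

Record smooth_curve : Type := SmoothCurve {
  curve_fun :> I01 R -> 'cV[R]_n.+1;
  curve_smooth : smooth curve_fun }.

HB.instance Definition _ := gen_eqMixin smooth_curve.
HB.instance Definition _ := gen_choiceMixin smooth_curve.

Definition Cinfty_derivn k (c : smooth_curve) : {uniform I01 R -> 'cV[R]_n.+1} :=
  cderivn k c.

(* C^oo topology: uniform convergence of all derivatives on [0, 1]. *)
HB.instance Definition _ := Topological.copy smooth_curve
  (sup_topology (fun k =>
     Topological.on (initial_topology (Cinfty_derivn k)))).

End CurveSpaces.

Section FrenetFrames.
Context {R : realType} {n : nat}.
Implicit Types (f : I01 R -> 'cV[R]_n.+1) (t : I01 R).

Definition spherical f : Prop := forall t, enorm (f t) = 1.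

Definition jet f t : seq 'cV[R]_n.+1 := [seq cderivn k f t | k <- iota 0 n].

Definition generic f : Prop := forall t, free (jet f t).

Definition locally_convex f : Prop :=
  forall t, 0 < \det (\matrix_(i < n.+1, k < n.+1) cderivn k f t i 0).

(* For generic f exactly one matrix satisfies the condition; the default 0   *)
(* is only taken when there is none.                                         *)
Definition frenet f t : 'M[R]_n.+1 :=
  xget 0 [set F | SO R n.+1 F /\
    forall j : 'I_n, col (widen_ord (leqnSn n) j) F = (gram_schmidt (jet f t))`_j].

(* z is the endpoint of the continuous lift, starting at e, of the Frenet    *)
(* frame of f along Pi : G -> SO(n+1).                                       *)
Definition frenet_lift_end (G : topologicalType) (Pi : G -> 'M[R]_n.+1) (e : G)
    f (z : G) : Prop :=
  exists F : I01 R -> G,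
    [/\ continuous F, (forall t, Pi (F t) = frenet f t),
        F (I01_start R) = e & F (I01_end R) = z].

Definition generic_space (G : topologicalType) (Pi : G -> 'M[R]_n.+1) (e z : G) :
    set (smooth_curve R n) :=
  [set c : smooth_curve R n |
    [/\ spherical c, generic c, frenet c (I01_start R) = 1%:M
      & frenet_lift_end Pi e c z]].

Definition locally_convex_space (G : topologicalType) (Pi : G -> 'M[R]_n.+1)
    (e z : G) : set (smooth_curve R n) :=
  [set c : smooth_curve R n |
    [/\ spherical c, locally_convex c, frenet c (I01_start R) = 1%:M
      & frenet_lift_end Pi e c z]].

End FrenetFrames.

Definition GS2 (R : realType) (z : spin3 R) : set (smooth_curve R 2) :=
  generic_space (@Pi3 R) (one3 R) z.

Definition LS2 (R : realType) (z : spin3 R) : set (smooth_curve R 2) :=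
  locally_convex_space (@Pi3 R) (one3 R) z.

Definition LS3 (R : realType) (z : spin4 R) : set (smooth_curve R 3) :=
  locally_convex_space (@Pi4 R) (one4 R) z.

Section GeodesicCurvature.
Context {R : realType}.
Implicit Type f : I01 R -> 'cV[R]_3.

Definition tangent f : I01 R -> 'cV[R]_3 :=
  fun t => (enorm (cderiv f t))^-1 *: cderiv f t.

Definition normal f : I01 R -> 'cV[R]_3 := fun t => cross (f t) (tangent f t).

Definition geodesic_curvature f (t : I01 R) : R :=
  dot (cderiv (tangent f) t) (normal f t) / enorm (cderiv f t).

End GeodesicCurvature.

(* Main.v *)
(* A curve g on S^3 with lifted frame (zl, zr) is g = zl zr^*, and the two curves on S^2 are
   gl = zl i zl^* and gr = zr i zr^*; since zl i zr^* = g' / |g'|, these are g'/|g'| g^* and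
   g^* g'/|g'|. Write zl' = zl a and zr' = zr b with a, b imaginary. Differentiating, (zl, zr) is
   the frame of a locally convex curve iff a = ((c1 + c3) i + c2 k) / 2 and
   b = ((c3 - c1) i + c2 k) / 2 with c1, c2, c3 > 0, whereas z i z^* with z' = z (p i + q k) / 2,
   q > 0, has frame z, speed q and geodesic curvature p / q. Hence both sides of the
   correspondence impose the same condition on (a, b).

   All these expressions are algebraic in the derivatives of the curves, except the lifts. A unit
   vector z is determined up to sign by P = z z^T, which is affine in the rotation covered by z.
   Continuous lifts with the same origin satisfy |z - y| <= |zz^T - yy^T| when the right-hand side
   is small, and z' = P' z - <z, P' z> z / 2, so that z and all its derivatives depend
   continuously on those of P. *)

(* Membership in each space supplies a lift as a path continuous in t, but says nothing about how
   that path varies with the curve. This dependence is the main obstacle, and the reason for working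
   with the single-valued projector z z^T.

   Continuity of both maps is treated by families. A map from a space T to curves is continuous
   exactly when all derivatives in t exist and are jointly continuous on T x [0, 1], a property
   preserved by sums, products and reciprocal square roots of positive functions. Taking for T the
   space of curves itself, one computation yields both the smoothness of the new curves and the
   continuity of the map that produces them.

   The two compositions are the identity for different reasons. Returning to a curve on S^3 uses
   uniqueness of the lifts of curves on S^2, because the signs of both factors enter zl zr^*.
   Returning to a pair on S^2 uses that zl i zl^* and zr i zr^* are unchanged by signs, hence
   determined by the rotation of R^4 covered by the pair. *)
Require Import Defs.
From mathcomp Require Import all_boot all_order all_algebra.
From mathcomp Require Import all_classical all_reals all_analysis.
From mathcomp Require Import ring lra.

Set Implicit Arguments.
Unset Strict Implicit.
Unset Printing Implicit Defensive.

Import Order.TTheory GRing.Theory Num.Theory.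
Import numFieldNormedType.Exports.
Local Open Scope classical_set_scope.
Local Open Scope ring_scope.

(** * Quaternions in coordinates *)

Section QuaternionCoordinates.
Context {R : realType}.
Implicit Types (a b c d : R) (u v : 'cV[R]_3) (p q z : 'cV[R]_(1 + 3)).

Definition vec3 a b c : 'cV[R]_3 := \col_i [:: a; b; c]`_i.

Definition quat4 a b c d := Quat a (vec3 b c d).

Lemma vec3E u : u = vec3 (u 0 0) (u 1 0) (u 2%:R 0).
Proof.
apply/colP => i; rewrite mxE; case: i => -[|[|[|//]]] ? /=;
  by congr (u _ 0); apply: val_inj.
Qed.

Lemma quat4_ex q : exists a b c d, q = quat4 a b c d.
Proof.
exists (qre q), (qim q 0 0), (qim q 1 0), (qim q 2%:R 0).
rewrite /quat4 -vec3E /Quat -[LHS]vsubmxK; congr col_mx.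
by apply/matrixP => i j; rewrite !ord1 [RHS]mxE eqxx mulr1n.
Qed.

Lemma Quat_qre a u : qre (Quat a u) = a.
Proof. by rewrite /qre /Quat col_mxKu mxE eqxx mulr1n. Qed.

Lemma Quat_qim a u : qim (Quat a u) = u.
Proof. by rewrite /qim /Quat col_mxKd. Qed.

Lemma QuatK q : Quat (qre q) (qim q) = q.
Proof. by have [a [b [c [d ->]]]] := quat4_ex q; rewrite Quat_qre Quat_qim. Qed.

Lemma dot3E u v : dot u v = u 0 0 * v 0 0 + u 1 0 * v 1 0 + u 2%:R 0 * v 2%:R 0.
Proof.
rewrite /dot !mxE !big_ord_recl big_ord0 !mxE addr0 addrA.
by do ![congr (_ + _)|congr (_ * _)|congr (_ _ 0)|apply: val_inj].
Qed.

Lemma dot_vec3 a b c a' b' c' :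
  dot (vec3 a b c) (vec3 a' b' c') = a * a' + b * b' + c * c'.
Proof. by rewrite dot3E !mxE. Qed.

Lemma dot_Quat a b u v : dot (Quat a u) (Quat b v) = a * b + dot u v.
Proof.
rewrite /dot /Quat tr_col_mx mul_row_col tr_scalar_mx -scalar_mxM.
by rewrite [LHS]mxE [in X in X + _]mxE eqxx mulr1n.
Qed.

Lemma cross_vec3 a b c a' b' c' :
  cross (vec3 a b c) (vec3 a' b' c') =
  vec3 (b * c' - c * b') (c * a' - a * c') (a * b' - b * a').
Proof. by rewrite [LHS]vec3E !mxE. Qed.

Lemma addv_vec3 a b c a' b' c' :
  vec3 a b c + vec3 a' b' c' = vec3 (a + a') (b + b') (c + c').
Proof. by rewrite [LHS]vec3E !mxE. Qed.

Lemma scalev_vec3 k a b c : k *: vec3 a b c = vec3 (k * a) (k * b) (k * c).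
Proof. by rewrite [LHS]vec3E !mxE. Qed.

Lemma oppv_vec3 a b c : - vec3 a b c = vec3 (- a) (- b) (- c).
Proof. by rewrite [LHS]vec3E !mxE. Qed.

Lemma vec3_0 : 0 = vec3 0 0 0.
Proof. by rewrite [LHS]vec3E !mxE. Qed.

Definition vec3_simpl := (cross_vec3, addv_vec3, scalev_vec3, oppv_vec3, dot_vec3).

Lemma qmul_quat4 a b c d a' b' c' d' :
  qmul (quat4 a b c d) (quat4 a' b' c' d') =
  quat4 (a * a' - (b * b' + c * c' + d * d'))
        (a * b' + a' * b + (c * d' - d * c'))
        (a * c' + a' * c + (d * b' - b * d'))
        (a * d' + a' * d + (b * c' - c * b')).
Proof. by rewrite /qmul /quat4 !Quat_qre !Quat_qim !vec3_simpl. Qed.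

Lemma qconj_quat4 a b c d : qconj (quat4 a b c d) = quat4 a (- b) (- c) (- d).
Proof. by rewrite /qconj /quat4 Quat_qre Quat_qim !vec3_simpl. Qed.

Lemma Quat_add a b u v : Quat a u + Quat b v = Quat (a + b) (u + v).
Proof. by rewrite /Quat add_col_mx -raddfD. Qed.

Lemma Quat_scale k a u : k *: Quat a u = Quat (k * a) (k *: u).
Proof. by rewrite /Quat scale_col_mx scale_scalar_mx. Qed.

Lemma Quat_opp a u : - Quat a u = Quat (- a) (- u).
Proof. by rewrite /Quat opp_col_mx -raddfN. Qed.

Lemma addq_quat4 a b c d a' b' c' d' :
  quat4 a b c d + quat4 a' b' c' d' = quat4 (a + a') (b + b') (c + c') (d + d').
Proof. by rewrite /quat4 Quat_add addv_vec3. Qed.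

Lemma scaleq_quat4 k a b c d :
  k *: quat4 a b c d = quat4 (k * a) (k * b) (k * c) (k * d).
Proof. by rewrite /quat4 Quat_scale scalev_vec3. Qed.

Lemma oppq_quat4 a b c d : - quat4 a b c d = quat4 (- a) (- b) (- c) (- d).
Proof. by rewrite /quat4 Quat_opp oppv_vec3. Qed.

Lemma dot_quat4 a b c d a' b' c' d' :
  dot (quat4 a b c d) (quat4 a' b' c' d') = a * a' + b * b' + c * c' + d * d'.
Proof. by rewrite dot_Quat dot_vec3 !addrA. Qed.

Definition quat4_simpl :=
  (qmul_quat4, qconj_quat4, addq_quat4, scaleq_quat4, oppq_quat4, dot_quat4).

Lemma quat4_entry a b c d (i : 'I_(1 + 3)) : quat4 a b c d i 0 = [:: a; b; c; d]`_i.
Proof.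
rewrite /quat4 /Quat mxE; case: splitP => j ->.
  by rewrite ord1 mxE eqxx mulr1n.
by rewrite mxE; case: j => -[|[|[|//]]].
Qed.

Lemma quat4_inj a b c d a' b' c' d' : quat4 a b c d = quat4 a' b' c' d' ->
  [/\ a = a', b = b', c = c' & d = d'].
Proof.
move=> /matrixP e.
move: (e 0 0) (e 1 0) (e 2%:R 0) (e 3%:R 0); by rewrite !quat4_entry.
Qed.

Lemma qmul_Quat0 (u v : 'cV[R]_3) :
  qmul (Quat 0 u) (Quat 0 v) = Quat (- dot u v) (cross u v).
Proof. by rewrite /qmul !Quat_qre !Quat_qim !scale0r !add0r mulr0 sub0r. Qed.

Lemma qconj_Quat0 (u : 'cV[R]_3) : qconj (Quat 0 u) = - Quat 0 u.
Proof. by rewrite /qconj Quat_qre Quat_qim Quat_opp oppr0. Qed.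

End QuaternionCoordinates.

(* Unification would otherwise unfold quaternion products down to matrix entries. *)
Opaque qmul qconj Quat cross.

Ltac quat4_coords q := have [? [? [? [? ->]]]] := quat4_ex q.

(** * Quaternion algebra and the rotations it induces *)

Section QuaternionAlgebra.
Context {R : realType}.
Implicit Types (a b c d k : R) (u v : 'cV[R]_3) (p q z : 'cV[R]_(1 + 3)).

Lemma qmulA p q z : qmul p (qmul q z) = qmul (qmul p q) z.
Proof.
quat4_coords p; quat4_coords q; quat4_coords z.
by rewrite !quat4_simpl; congr quat4; ring.
Qed.

Definition qone : 'cV[R]_(1 + 3) := quat4 1 0 0 0.
Definition qi : 'cV[R]_(1 + 3) := quat4 0 1 0 0.
Definition qj : 'cV[R]_(1 + 3) := quat4 0 0 1 0.
Definition qk : 'cV[R]_(1 + 3) := quat4 0 0 0 1.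

Lemma qmul1q q : qmul qone q = q.
Proof. by quat4_coords q; rewrite !quat4_simpl; congr quat4; ring. Qed.

Lemma qmulq1 q : qmul q qone = q.
Proof. by quat4_coords q; rewrite !quat4_simpl; congr quat4; ring. Qed.

Lemma qmulDl p q z : qmul (p + q) z = qmul p z + qmul q z.
Proof.
quat4_coords p; quat4_coords q; quat4_coords z.
by rewrite !quat4_simpl; congr quat4; ring.
Qed.

Lemma qmulDr p q z : qmul z (p + q) = qmul z p + qmul z q.
Proof.
quat4_coords p; quat4_coords q; quat4_coords z.
by rewrite !quat4_simpl; congr quat4; ring.
Qed.

Lemma qmulZl k p q : qmul (k *: p) q = k *: qmul p q.
Proof.
quat4_coords p; quat4_coords q.
by rewrite !quat4_simpl; congr quat4; ring.
Qed.

Lemma qmulZr k p q : qmul p (k *: q) = k *: qmul p q.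
Proof.
quat4_coords p; quat4_coords q.
by rewrite !quat4_simpl; congr quat4; ring.
Qed.

Lemma qconjM p q : qconj (qmul p q) = qmul (qconj q) (qconj p).
Proof.
quat4_coords p; quat4_coords q.
by rewrite !quat4_simpl; congr quat4; ring.
Qed.

Lemma qconjK q : qconj (qconj q) = q.
Proof. by quat4_coords q; rewrite !quat4_simpl; congr quat4; ring. Qed.

Lemma dot_qconj p q : dot (qconj p) (qconj q) = dot p q.
Proof. by quat4_coords p; quat4_coords q; rewrite !quat4_simpl; ring. Qed.

Lemma qmul_conjq q : qmul (qconj q) q = dot q q *: qone.
Proof. by quat4_coords q; rewrite !quat4_simpl; congr quat4; ring. Qed.

Lemma qmulq_conj q : qmul q (qconj q) = dot q q *: qone.
Proof. by quat4_coords q; rewrite !quat4_simpl; congr quat4; ring. Qed.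

Lemma dot_qmul2l z p q : dot (qmul z p) (qmul z q) = dot z z * dot p q.
Proof.
quat4_coords p; quat4_coords q; quat4_coords z.
by rewrite !quat4_simpl; ring.
Qed.

Lemma dot_qmul2r z p q : dot (qmul p z) (qmul q z) = dot z z * dot p q.
Proof.
quat4_coords p; quat4_coords q; quat4_coords z.
by rewrite !quat4_simpl; ring.
Qed.

(** For z other than -1 a root is (1 + z) / |1 + z|, the half-angle formula; for z = -1 the unit i
    serves. The roots exhibit each rotation matrix as a square, whence its determinant is 1. *)
Lemma unit_qsqrt z : dot z z = 1 -> exists2 w, dot w w = 1 & qmul w w = z.
Proof.
have [a [b [c [d ->]]]] := quat4_ex z; rewrite dot_quat4 => z1.
have [a1|an1] := eqVneq a (- 1).
  exists qi; first by rewrite !quat4_simpl; ring.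
  have s0 : b ^+ 2 + (c ^+ 2 + d ^+ 2) = 0.
    by apply: (addrI (a * a)); rewrite addr0 [in RHS]a1 mulrNN mulr1 -z1; ring.
  move: s0 => /eqP; rewrite paddr_eq0 ?addr_ge0 ?sqr_ge0// => /andP[/eqP b0].
  rewrite paddr_eq0 ?sqr_ge0// => /andP[/eqP c0 /eqP d0].
  move: b0 c0 d0 => /eqP + /eqP + /eqP; rewrite !sqrf_eq0 => /eqP-> /eqP-> /eqP->.
  by rewrite a1 !quat4_simpl; congr quat4; ring.
have a1 : 0 < 1 + a.
  rewrite lt_neqAle eq_sym addrC addr_eq0 an1 /= -[_ + _]opprK oppr_ge0.
  by rewrite leNgt; apply/negP => ?; nra.
(* The norm being inverted is that of 1 + z: |1 + z|^2 = (1 + a)^2 + 1 - a^2 = 2 (1 + a). *)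
set k := (Num.sqrt (2 * (1 + a)))^-1.
have kk : k * k * (2 * (1 + a)) = 1.
  rewrite -[2 * _]sqr_sqrtr; last by lra.
  by rewrite -expr2 exprVn mulVf// sqrf_eq0 gt_eqF// sqrtr_gt0; lra.
have dd : b * b + c * c + d * d = 1 - a * a by rewrite -z1; ring.
exists (k *: quat4 (1 + a) b c d); rewrite !quat4_simpl.
  transitivity (k * k * ((1 + a) * (1 + a) + (b * b + c * c + d * d))); first by ring.
  by rewrite dd -[RHS]kk; ring.
congr quat4; last 3 first.
- by rewrite -[RHS]mul1r -[in RHS]kk; ring.
- by rewrite -[RHS]mul1r -[in RHS]kk; ring.
- by rewrite -[RHS]mul1r -[in RHS]kk; ring.
transitivity (k * k * ((1 + a) * (1 + a) - (b * b + c * c + d * d))); first by ring.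
by rewrite dd -[RHS]mul1r -[in RHS]kk; ring.
Qed.

Definition rot4 z y q := qmul (qmul z q) (qconj y).

Definition rot3 z u := qim (rot4 z z (Quat 0 u)).

Lemma rot4M z y w x q : rot4 (qmul z w) (qmul y x) q = rot4 z y (rot4 w x q).
Proof. by rewrite /rot4 qconjM !qmulA. Qed.

Lemma rot4D z y p q : rot4 z y (p + q) = rot4 z y p + rot4 z y q.
Proof. by rewrite /rot4 qmulDr qmulDl. Qed.

Lemma rot4Z z y k q : rot4 z y (k *: q) = k *: rot4 z y q.
Proof. by rewrite /rot4 qmulZr qmulZl. Qed.

Lemma dot_rot4 z y p q : dot z z = 1 -> dot y y = 1 ->
  dot (rot4 z y p) (rot4 z y q) = dot p q.
Proof.
by move=> z1 y1; rewrite /rot4 dot_qmul2r dot_qmul2l dot_qconj z1 y1 !mul1r.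
Qed.

Lemma qre_rot4 z q : qre (rot4 z z q) = dot z z * qre q.
Proof.
quat4_coords z; quat4_coords q.
by rewrite /rot4 !quat4_simpl !Quat_qre; ring.
Qed.

(** Conjugation keeps a vanishing real part, so the [qim] in [rot3] loses nothing. *)
Lemma Quat_rot3 z u : Quat 0 (rot3 z u) = rot4 z z (Quat 0 u).
Proof.
by rewrite -[RHS]QuatK qre_rot4 Quat_qre mulr0.
Qed.

Lemma Quat0_inj : injective (Quat 0 : 'cV[R]_3 -> 'cV[R]_(1 + 3)).
Proof. by move=> u v /(congr1 qim); rewrite !Quat_qim. Qed.

Lemma rot3M z w u : rot3 (qmul z w) u = rot3 z (rot3 w u).
Proof. by apply: Quat0_inj; rewrite !Quat_rot3 rot4M. Qed.

Lemma Quat0D u v : Quat 0 (u + v) = Quat 0 u + Quat 0 v.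
Proof. by rewrite Quat_add addr0. Qed.

Lemma Quat0Z k u : Quat 0 (k *: u) = k *: Quat 0 u.
Proof. by rewrite Quat_scale mulr0. Qed.

Lemma rot3D z u v : rot3 z (u + v) = rot3 z u + rot3 z v.
Proof. by apply: Quat0_inj; rewrite Quat_rot3 !Quat0D rot4D -!Quat_rot3. Qed.

Lemma rot3Z z k u : rot3 z (k *: u) = k *: rot3 z u.
Proof. by apply: Quat0_inj; rewrite Quat_rot3 !Quat0Z rot4Z -!Quat_rot3. Qed.

Lemma dot_rot3 z u v : dot z z = 1 -> dot (rot3 z u) (rot3 z v) = dot u v.
Proof.
have dQ (x y : 'cV[R]_3) : dot x y = dot (Quat 0 x) (Quat 0 y) by rewrite dot_Quat mulr0 add0r.
by move=> z1; rewrite dQ (Quat_rot3 z u) (Quat_rot3 z v) dot_rot4// -dQ.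
Qed.

End QuaternionAlgebra.

(** * Rotation matrices *)

Section RotationMatrices.
Context {R : realType}.

Definition mx_of n (f : 'cV[R]_n -> 'cV[R]_n) : 'M[R]_n :=
  \matrix_(i, j) f (delta_mx j 0) i 0.

Lemma dot_delta n (i j : 'I_n) :
  dot (delta_mx i 0 : 'cV[R]_n) (delta_mx j 0) = (i == j)%:R.
Proof.
rewrite /dot mxE (bigD1 i)//= !mxE !eqxx mul1r big1 ?addr0 ?andbT => [//|k ki].
by rewrite !mxE (negPf ki) mul0r.
Qed.

Section Linear.
Context {n : nat} (f : 'cV[R]_n -> 'cV[R]_n).
Hypothesis fD : forall u v, f (u + v) = f u + f v.
Hypothesis fZ : forall k u, f (k *: u) = k *: f u.

Lemma mul_mx_of u : mx_of f *m u = f u.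
Proof.
have f0 : f 0 = 0 by have := fZ 0 0; rewrite !scale0r.
rewrite [in RHS](matrix_sum_delta u) (big_morph f fD f0).
apply/colP => i; rewrite mxE summxE; apply: eq_bigr => j _.
by rewrite big_ord1 fZ !mxE mulrC.
Qed.

Lemma col_mx_of j : col j (mx_of f) = f (delta_mx j 0).
Proof. by apply/colP => i; rewrite !mxE. Qed.

Hypothesis f_dot : forall u v, dot (f u) (f v) = dot u v.

Lemma mx_of_orthogonal : (mx_of f)^T *m mx_of f = 1%:M.
Proof.
apply/matrixP => i j; rewrite [RHS]mxE -dot_delta -f_dot /dot !mxE.
by apply: eq_bigr => k _; rewrite !mxE.
Qed.

(** Orthogonality leaves the sign of the determinant open; for the square of an orthogonal matrix M
    it is settled by det M det M = det (M^T M) = 1. *)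
Lemma mx_of_sqr_SO g : (forall u, g u = f (f u)) -> SO R n (mx_of g).
Proof.
move=> gff.
have -> : mx_of g = mx_of f *m mx_of f.
  apply/matrixP => i j; rewrite !mxE gff -mul_mx_of mxE.
  by apply: eq_bigr => k _; rewrite !mxE.
have o := mx_of_orthogonal.
split; first by rewrite trmx_mul -mulmxA (mulmxA _ (mx_of f)) o mul1mx o.
by rewrite det_mulmx -[X in X * _]det_tr -det_mulmx o det1.
Qed.

End Linear.

Lemma Pi3E (z : spin3 R) : Pi3 z = mx_of (rot3 (\val z)).
Proof. by []. Qed.

Lemma Pi4E (z : spin4 R) : Pi4 z = mx_of (rot4 (\val z.1) (\val z.2)).
Proof. by []. Qed.

Lemma dot_sqr_ge0 n (u : 'cV[R]_n) : 0 <= dot u u.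
Proof. by rewrite /dot mxE sumr_ge0// => i _; rewrite !mxE sqr_ge0. Qed.

Lemma enorm_sqr n (u : 'cV[R]_n) : enorm u ^+ 2 = dot u u.
Proof. by rewrite sqr_sqrtr ?dot_sqr_ge0. Qed.

Lemma enorm1P n (u : 'cV[R]_n) : enorm u = 1 <-> dot u u = 1.
Proof.
split=> [u1|u1]; first by rewrite -enorm_sqr u1 expr1n.
by rewrite /enorm u1 sqrtr1.
Qed.

Lemma spin3_unit (z : spin3 R) : dot (\val z) (\val z) = 1.
Proof. by apply/enorm1P; have := valP z; rewrite inE. Qed.

Lemma Pi3_SO (z : spin3 R) : SO R 3 (Pi3 z).
Proof.
have [w w1 ww] := unit_qsqrt (spin3_unit z); rewrite Pi3E.
apply: (mx_of_sqr_SO (rot3D w) (rot3Z w) (fun u v => dot_rot3 u v w1)) => u.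
by rewrite -rot3M ww.
Qed.

Lemma Pi4_SO (z : spin4 R) : SO R 4 (Pi4 z).
Proof.
have [w w1 ww] := unit_qsqrt (spin3_unit z.1).
have [x x1 xx] := unit_qsqrt (spin3_unit z.2); rewrite Pi4E.
apply: (mx_of_sqr_SO (rot4D w x) (rot4Z w x) (fun u v => dot_rot4 u v w1 x1)) => u.
by rewrite -rot4M ww xx.
Qed.

Lemma mul_Pi3 (z : spin3 R) u : Pi3 z *m u = rot3 (\val z) u.
Proof. by rewrite Pi3E (mul_mx_of (rot3D _) (rot3Z _)). Qed.

Lemma mul_Pi4 (z : spin4 R) q : Pi4 z *m q = rot4 (\val z.1) (\val z.2) q.
Proof. by rewrite Pi4E (mul_mx_of (rot4D _ _) (rot4Z _ _)). Qed.

End RotationMatrices.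

(** * Calculus on the unit interval *)

Section UnitInterval.
Context {R : realType}.
Implicit Types (t s : I01 R).

Lemma I01_itv t : 0 <= \val t <= 1.
Proof. by have := valP t; rewrite inE /= in_itv. Qed.

Lemma val_I01_continuous : continuous (\val : I01 R -> R).
Proof. exact: initial_continuous. Qed.

Lemma nbhs_I01P t (A : set (I01 R)) :
  nbhs t A <-> exists2 e, 0 < e & forall s, `|\val s - \val t| < e -> A s.
Proof.
split.
  case=> _ [[W oW <-] /= Wt WA].
  have /nbhs_ballP[e e0 eW] : nbhs (\val t) W by exact: open_nbhs_nbhs.
  by exists e => // s st; apply: WA; apply: eW; rewrite /ball /= distrC.
move=> [e e0 eA].
have : nbhs t [set s | ball (\val t) e (\val s)].
  exact: (val_I01_continuous (nbhsx_ballx _ _ e0)).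
by apply: filterS => s; rewrite /ball /= distrC => /eA.
Qed.

(** Uniqueness of limits along t^' rests on this: every t, endpoints included, must be approached by
    other points of [0, 1]. *)
Lemma dnbhs_I01_proper t : ProperFilter t^'.
Proof.
apply: Build_ProperFilter_ex => A /nbhs_I01P[e e0 eA].
have [t0 t1] := andP (I01_itv t).
have [r [r01 rt rtn]] : exists r, [/\ 0 <= r <= 1, `|r - \val t| < e & r != \val t].
  (* The approach is directed towards the farther endpoint, so that a shift of at most 1 / 2 stays
     inside [0, 1]. *)
  have [tle|tgt] := leP (\val t) (1 / 2).
    exists (\val t + Num.min (e / 2) (1 / 2)); rewrite addrAC subrr add0r.
    have m0 : 0 < Num.min (e / 2) (1 / 2) by rewrite lt_min; apply/andP; split; lra.
    have m1 : Num.min (e / 2) (1 / 2) <= 1 / 2 by rewrite ge_min lexx orbT.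
    have m2 : Num.min (e / 2) (1 / 2) <= e / 2 by rewrite ge_min lexx.
    by split; [apply/andP; split; lra | rewrite gtr0_norm//; lra
              | rewrite -subr_eq0 addrAC subrr add0r gt_eqF].
  exists (\val t - Num.min (e / 2) (1 / 2)); rewrite addrAC subrr add0r normrN.
  have m0 : 0 < Num.min (e / 2) (1 / 2) by rewrite lt_min; apply/andP; split; lra.
  have m1 : Num.min (e / 2) (1 / 2) <= 1 / 2 by rewrite ge_min lexx orbT.
  have m2 : Num.min (e / 2) (1 / 2) <= e / 2 by rewrite ge_min lexx.
  by split; [apply/andP; split; lra | rewrite gtr0_norm//; lra
            | rewrite -subr_eq0 addrAC subrr add0r oppr_eq0 gt_eqF].
have rI : r \in `[0 : R, 1]%classic by rewrite inE /= in_itv.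
exists (SigSub rI : I01 R); exact: eA.
Qed.

(** Retraction of the line onto [0, 1]; through it compactness of segments and the intermediate
    value theorem reach the subtype [I01]. *)
Definition clamp (x : R) : R := Num.max 0 (Num.min x 1).

Lemma clamp_itv x : clamp x \in `[0 : R, 1]%classic.
Proof.
by rewrite inE /= in_itv /= le_max lexx /= ge_max ler01 ge_min lexx orbT.
Qed.

Definition toI01 (x : R) : I01 R := SigSub (clamp_itv x).

Lemma toI01K t : toI01 (\val t) = t.
Proof.
apply: val_inj; rewrite /= /clamp; have /andP[t0 t1] := I01_itv t.
by rewrite min_l// max_r.
Qed.

Lemma toI01_continuous : continuous toI01.
Proof.
apply: continuous_comp_initial => x.
have c0 (a : R) : {for x, continuous (cst a : R -> R^o)} by exact: cst_continuous.
have cid : {for x, continuous (id : R -> R^o)} by exact: cvg_id.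
exact: (continuous_max (c0 0) (continuous_min cid (c0 1))).
Qed.

Lemma I01_compact : compact [set: I01 R].
Proof.
have -> : [set: I01 R] = toI01 @` `[0, 1]%classic.
  apply/seteqP; split => // t _; exists (\val t); last exact: toI01K.
  by rewrite /= in_itv /= I01_itv.
apply: continuous_compact; last exact: segment_compact.
by apply: continuous_subspaceT => x; exact: toI01_continuous.
Qed.

(** Tube lemma, from compactness of [0, 1] in its near-covering form. It turns joint continuity into
    uniformity in t. *)
Lemma near_tube (T : topologicalType) (A : set (T * I01 R)) (x : T) :
  (forall t, \forall p \near (x, t), A p) ->
  \forall y \near x, forall t, A (y, t).
Proof.
move=> Anear.
have /compact_near_coveringP cov := I01_compact.
have := cov _ (nbhs x) (fun y t => A (y, t)) (nbhs_filter x).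
have h : forall t, [set: I01 R] t -> \forall t' \near t & y \near x, A (y, t').
  move=> t _; have [[U V] /= [Ux Vt] UV] := Anear t.
  by exists (V, U) => // -[s y] /= [Vs Uy]; apply: UV.
by move=> /(_ h); apply: filterS => y Ay t; exact: Ay.
Qed.

(** A nonpositive value at t would force a zero between 0 and t by the intermediate value
    theorem. *)
Lemma I01_nonvanishing_gt0 (f : I01 R -> R) : continuous f ->
  0 < f (I01_start R) -> (forall t, f t != 0) -> forall t, 0 < f t.
Proof.
move=> fc f0 fn t; rewrite ltNge; apply/negP => ft.
have /andP[t0 t1] := I01_itv t.
have st0 : toI01 0 = I01_start R by rewrite -[RHS]toI01K.
have [||c _] := @IVT _ (f \o toI01) 0 (\val t) 0 t0.
- apply: continuous_subspaceT => x.
  by apply: continuous_comp; [exact: toI01_continuous|exact: fc].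
- by rewrite /= st0 toI01K ge_min le_max ft (ltW f0) orbT.
- by move=> /eqP; apply/negP; exact: fn.
Qed.

End UnitInterval.

(** * One-variable derivatives on [0, 1] *)

Section Derivatives.
Context {R : realType}.
Implicit Types (f g : I01 R -> R) (t : I01 R).

(** The quotients of [diff_quot] in one coordinate. As a relation it asserts existence and value of
    the derivative together, one-sided at the endpoints. *)
Definition is_d f f' := forall t : I01 R,
  (\val s - \val t)^-1 * (f s - f t) @[s --> t^'] --> (f' t : R).

Lemma is_d_unique f g h : is_d f g -> is_d f h -> g = h.
Proof.
move=> fg fh; apply/funext => t; have := dnbhs_I01_proper t => tP.
exact: (cvg_unique _ (fg t) (fh t)).
Qed.

Lemma is_d_continuous f g : is_d f g -> continuous f.
Proof.
move=> fg t.
have ft : f s @[s --> t^'] --> f t.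
  have vt : \val s @[s --> t^'] --> \val t.
    by apply: cvg_within_filter; exact: (@val_I01_continuous R t).
  (* For s distinct from t, this expression is f s, recovered from its difference quotient. *)
  have h : f t + (\val s - \val t) * ((\val s - \val t)^-1 * (f s - f t)) @[s --> t^']
      --> f t + (\val t - \val t) * g t.
    apply: cvgD; first exact: cvg_cst.
    by apply: cvgM (fg t); apply: cvgB => //; exact: cvg_cst.
  rewrite subrr mul0r addr0 in h; apply: cvg_trans h.
  apply: near_eq_cvg; near=> s.
  have st : \val s - \val t != 0.
    have : s != t by near: s; exact: nbhs_dnbhs_neq.
    by rewrite subr_eq0; apply: contra_neq => /val_inj.
  by rewrite mulrA divff// mul1r addrC subrK.
move=> A fA; have : \forall s \near t, s != t -> A (f s) by exact: (ft A fA).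
apply: filterS => s h; have [->|] := eqVneq s t; first exact: nbhs_singleton fA.
exact: h.
Unshelve. all: by end_near. Qed.

Lemma cvg_dnbhs f t : continuous f -> f s @[s --> t^'] --> f t.
Proof.
by move=> fc; apply: cvg_within_filter; exact: fc.
Qed.

Lemma is_d_eq f g h : is_d f g -> g = h -> is_d f h.
Proof. by move=> ? <-. Qed.

Lemma is_d_cst (a : R) : is_d (fun=> a) (fun=> 0).
Proof.
move=> t; apply: cvg_near_cst; apply: nearW => s.
by rewrite subrr mulr0.
Qed.

Lemma is_dD f f' g g' : is_d f f' -> is_d g g' ->
  is_d (fun t => f t + g t) (fun t => f' t + g' t).
Proof.
move=> df dg t.
rewrite [X in X @ _](_ : _ = fun s => (\val s - \val t)^-1 * (f s - f t)
  + (\val s - \val t)^-1 * (g s - g t)); last by apply/funext => s; ring.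
exact: cvgD (df t) (dg t).
Qed.

Lemma is_dM f f' g g' : is_d f f' -> is_d g g' ->
  is_d (fun t => f t * g t) (fun t => f' t * g t + f t * g' t).
Proof.
move=> df dg t.
rewrite [X in X @ _](_ : _ = fun s => (\val s - \val t)^-1 * (f s - f t) * g s
  + f t * ((\val s - \val t)^-1 * (g s - g t))); last by apply/funext => s; ring.
apply: cvgD; apply: cvgM; [exact: df | | exact: cvg_cst | exact: dg].
exact/cvg_dnbhs/(is_d_continuous dg).
Qed.

Lemma is_dN g g' : is_d g g' -> is_d (fun t => - g t) (fun t => - g' t).
Proof.
move=> dg; rewrite (_ : (fun _ => _) = fun t => (-1) * g t); last first.
  by apply/funext => t; rewrite mulN1r.
apply: is_d_eq; first by apply: is_dM dg; exact: is_d_cst.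
by apply/funext => t; ring.
Qed.

(** The one non-polynomial operation in Gram-Schmidt. With r = [rsqrt] f, the derivative - f' r^3 /
    2 is polynomial in f' and r, so smoothness follows by induction on the order. *)
Definition rsqrt (x : R) := (Num.sqrt x)^-1.

Lemma rsqrt_gt0 x : 0 < x -> 0 < rsqrt x.
Proof. by move=> x0; rewrite invr_gt0 sqrtr_gt0. Qed.

Lemma rsqrt_sqr x : 0 < x -> rsqrt x * rsqrt x = x^-1.
Proof. by move=> x0; rewrite -invfM -expr2 sqr_sqrtr// ltW. Qed.

Lemma is_d_rsqrt f f' : (forall t, 0 < f t) -> is_d f f' ->
  is_d (fun t => rsqrt (f t))
       (fun t => - 2^-1 * (f' t * (rsqrt (f t) * (rsqrt (f t) * rsqrt (f t))))).
Proof.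
move=> f0 df t; set r := fun t => rsqrt (f t).
have r0 s : 0 < r s by exact: rsqrt_gt0.
have rc : r s @[s --> t^'] --> r t.
  apply: cvgV; first by rewrite gt_eqF// sqrtr_gt0.
  have fc : continuous f := is_d_continuous df.
  apply: cvg_dnbhs => u; apply: continuous_comp; last exact: sqrt_continuous.
  exact: fc.
(* Rationalised difference: since f = r^-2, r s - r t = - (f s - f t) (r s)^2 (r t)^2 / (r s + r
   t). *)
rewrite [X in X @ _](_ : _ = fun s => - ((\val s - \val t)^-1 * (f s - f t) *
  ((r s + r t)^-1 * (r s * r s * (r t * r t))))); last first.
  apply/funext => s.
  have fs : f s = (r s * r s)^-1 by rewrite rsqrt_sqr// invrK.
  have ft : f t = (r t * r t)^-1 by rewrite rsqrt_sqr// invrK.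
  rewrite -/(r s) -/(r t) fs ft; have := r0 s; have := r0 t.
  set k := (_ - _)^-1; move: (r s) (r t) k => a b k b0 a0.
  by field; rewrite ?gt_eqF ?addr_gt0.
have -> : - 2^-1 * (f' t * (rsqrt (f t) * (rsqrt (f t) * rsqrt (f t)))) =
  - (f' t * ((r t + r t)^-1 * (r t * r t * (r t * r t)))).
  by rewrite -/(r t); have := r0 t; move: (r t) => a a0; field; rewrite ?gt_eqF ?addr_gt0.
apply: cvgN; apply: cvgM; first exact: df.
apply: cvgM.
  apply: cvgV; first by rewrite gt_eqF ?addr_gt0.
  by apply: cvgD => //; exact: cvg_cst.
by apply: cvgM; [apply: cvgM | exact: cvg_cst].
Qed.

End Derivatives.

Lemma continuous_pair (A B C : topologicalType) (f : A -> B) (h : A -> C) :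
  continuous f -> continuous h -> continuous (fun x => (f x, h x) : B * C).
Proof. by move=> fc hc x; exact: (cvg_pair (fc x) (hc x)). Qed.

(** * Smooth families and the $C^\infty$ topology *)

Section SmoothFamilies.
Context {R : realType} {T : topologicalType}.
Implicit Types (u v : T -> I01 R -> R) (k : nat).

Definition joint_continuous u := continuous (fun p : T * I01 R => u p.1 p.2).

Fixpoint Ck k u : Prop :=
  joint_continuous u /\
  if k is k'.+1 then exists2 u', (forall x, is_d (u x) (u' x)) & Ck k' u'
  else True.

(* For a single parameter value this is smoothness; by compactness of [0, 1], joint continuity of
   all derivatives also says that x |-> u x is continuous for the C^oo topology. *)
Definition Csm u := forall k, Ck k u.

Lemma Ck_joint k u : Ck k u -> joint_continuous u.
Proof. by case: k => [|k] []. Qed.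

Lemma CkS k u : Ck k.+1 u -> Ck k u.
Proof.
elim: k u => [|k IH] u; first by case=> ? [].
by move=> [uc [u' du /IH u'k]]; split=> //; exists u'.
Qed.

(** [Csm] provides a first derivative separately for each order; uniqueness of derivatives makes
    them one function, which is then of every order. *)
Lemma Csm_d u : Csm u -> exists2 u', (forall x, is_d (u x) (u' x)) & Csm u'.
Proof.
move=> su; have [_ [u' du _]] := su 1%N; exists u' => // k.
have [_ [u'' du' u''k]] := su k.+1.
suff -> : u' = u'' by [].
by apply/funext => x; exact: is_d_unique (du x) (du' x).
Qed.

Lemma Csm_is_d u u' : Csm u -> (forall x, is_d (u x) (u' x)) -> Csm u'.
Proof.
move=> /Csm_d[u'' du'' su'' du'].
suff -> : u' = u'' by [].
by apply/funext => x; exact: is_d_unique (du' x) (du'' x).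
Qed.

Lemma Ck_cst k (a : R) : Ck k (fun _ _ => a).
Proof.
elim: k a => [|k IH] a; (split; first by move=> p; exact: cvg_cst) => //.
by exists (fun _ _ => 0) => // x; exact: is_d_cst.
Qed.

Lemma CkD k u v : Ck k u -> Ck k v -> Ck k (fun x t => u x t + v x t).
Proof.
elim: k u v => [|k IH] u v [uc ud] [vc vd].
  by split=> // p; apply: cvgD; [exact: uc|exact: vc].
split; first by move=> p; apply: cvgD; [exact: uc|exact: vc].
have [u' du cu] := ud; have [v' dv cv] := vd.
exists (fun x t => u' x t + v' x t); last exact: IH.
by move=> x; exact: is_dD.
Qed.

Lemma CkM k u v : Ck k u -> Ck k v -> Ck k (fun x t => u x t * v x t).
Proof.
elim: k u v => [|k IH] u v uk vk; have [uc ud] := uk; have [vc vd] := vk.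
  by split=> // p; apply: cvgM; [exact: uc|exact: vc].
split; first by move=> p; apply: cvgM; [exact: uc|exact: vc].
have [u' du cu] := ud; have [v' dv cv] := vd.
exists (fun x t => u' x t * v x t + u x t * v' x t).
  by move=> x; exact: is_dM.
by apply: CkD; apply: IH => //; exact: CkS.
Qed.

Lemma Ck_rsqrt k u : (forall x t, 0 < u x t) -> Ck k u ->
  Ck k (fun x t => rsqrt (u x t)).
Proof.
move=> u0; have jr : joint_continuous u -> joint_continuous (fun x t => rsqrt (u x t)).
  move=> uc p; apply: cvgV; first by rewrite gt_eqF// sqrtr_gt0.
  by apply: (continuous_comp (uc _)); exact: sqrt_continuous.
elim: k => [|k IH] uk; have [uc ud] := uk; split=> //; try exact: jr.
have [u' du cu] := ud; have rk := IH (CkS uk).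
exists (fun x t => - 2^-1 * (u' x t * (rsqrt (u x t) * (rsqrt (u x t) * rsqrt (u x t))))).
  by move=> x; exact: is_d_rsqrt.
by apply: CkM; [exact: Ck_cst | do !apply: CkM].
Qed.

Lemma Csm_cst (a : R) : Csm (fun _ _ => a).
Proof. by move=> k; exact: Ck_cst. Qed.

Lemma CsmD u v : Csm u -> Csm v -> Csm (fun x t => u x t + v x t).
Proof. by move=> su sv k; exact: CkD. Qed.

Lemma CsmM u v : Csm u -> Csm v -> Csm (fun x t => u x t * v x t).
Proof. by move=> su sv k; exact: CkM. Qed.

Lemma CsmN u : Csm u -> Csm (fun x t => - u x t).
Proof.
move=> su; rewrite (_ : (fun _ _ => _) = fun x t => (-1) * u x t).
  by apply: CsmM => //; exact: Csm_cst.
by apply/funext => x; apply/funext => t; rewrite mulN1r.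
Qed.

Lemma Csm_rsqrt u : (forall x t, 0 < u x t) -> Csm u ->
  Csm (fun x t => rsqrt (u x t)).
Proof. by move=> u0 su k; exact: Ck_rsqrt. Qed.

End SmoothFamilies.

Section VectorFunctions.
Context {R : realType}.

Lemma cvg_col (U : Type) (F : set_system U) (FF : Filter F) n
    (f : U -> 'cV[R]_n) (l : 'cV[R]_n) :
  f x @[x --> F] --> l <-> forall i, f x i 0 @[x --> F] --> l i 0.
Proof.
split=> [fl i|fl].
  move=> A lA; apply: (fl [set M : 'cV[R]_n | A (M i 0)]).
  exact: (@coord_continuous R n 1 i 0 l A lA).
move=> A [P lP PA].
have : \forall x \near F, forall i, P i 0 (f x i 0).
  by apply: filter_forall => i; apply: (fl i); exact: lP.
by apply: filterS => x Px; apply: PA => i j; rewrite ord1.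
Qed.

Definition is_dV n (f f' : I01 R -> 'cV[R]_n) :=
  forall i, is_d (fun t => f t i 0) (fun t => f' t i 0).

Section DiffQuot.
Context {n : nat}.
Implicit Types f : I01 R -> 'cV[R]_n.+1.

Lemma diff_quotE f t s i :
  diff_quot f t s i 0 = (\val s - \val t)^-1 * (f s i 0 - f t i 0).
Proof. by rewrite !mxE. Qed.

Lemma is_dVP f f' : is_dV f f' <-> forall t, diff_quot f t s @[s --> t^'] --> f' t.
Proof.
split=> [df t|df i t].
  apply/cvg_col => i; under eq_fun => s do rewrite diff_quotE.
  exact: df.
have /cvg_col/(_ i) := df t.
by under eq_fun => s do rewrite diff_quotE.
Qed.

Lemma is_dV_cderiv f f' : is_dV f f' -> cderiv f = f'.
Proof.
move=> /is_dVP df; apply/funext => t; have := dnbhs_I01_proper t => tP.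
exact: cvg_lim (df t).
Qed.

Lemma cderiv_is_dV f : (forall t, cvg (diff_quot f t @ t^')) -> is_dV f (cderiv f).
Proof. by move=> df; apply/is_dVP => t; exact: df. Qed.

End DiffQuot.
End VectorFunctions.

Section SmoothVectorFamilies.
Context {R : realType} {T : topologicalType}.

Definition CsmV n (u : T -> I01 R -> 'cV[R]_n) := forall i, Csm (fun x t => u x t i 0).

Lemma CsmV_d n (u : T -> I01 R -> 'cV[R]_n) : CsmV u ->
  exists2 u', (forall x, is_dV (u x) (u' x)) & CsmV u'.
Proof.
move=> su.
have /choice[u' u'P] i : exists u', (forall x, is_d (fun t => u x t i 0) (u' x)) /\ Csm u'.
  by have [v] := Csm_d (su i); exists v.
exists (fun x t => \col_i u' i x t) => [x i|i].
  by under [X in is_d _ X]eq_fun => t do rewrite mxE; exact: (u'P i).1.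
rewrite (_ : (fun _ _ => _) = u' i); first exact: (u'P i).2.
by apply/funext => x; apply/funext => t; rewrite mxE.
Qed.

Lemma CsmV_is_dV n (u u' : T -> I01 R -> 'cV[R]_n) :
  CsmV u -> (forall x, is_dV (u x) (u' x)) -> CsmV u'.
Proof. by move=> su du i; apply: Csm_is_d (su i) _ => x; exact: du. Qed.

Lemma CsmV_joint n (u : T -> I01 R -> 'cV[R]_n) : CsmV u ->
  continuous (fun p : T * I01 R => u p.1 p.2).
Proof. by move=> su p; apply/cvg_col => i; exact: (Ck_joint (su i 0%N)). Qed.

Context {n : nat}.
Implicit Types u : T -> I01 R -> 'cV[R]_n.+1.

Lemma CsmV_cderivn u k : CsmV u ->
  CsmV (fun x => cderivn k (u x)) /\
  forall x, is_dV (cderivn k (u x)) (cderivn k.+1 (u x)).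
Proof.
elim: k u => [|k IH] u su.
  split=> // x; have [u' du _] := CsmV_d su.
  by rewrite /cderivn /= (is_dV_cderiv (du x)).
have [sk dk] := IH _ su; have sk1 := CsmV_is_dV sk dk.
split; [exact: sk1|move=> x]; have [u' du _] := CsmV_d sk1.
by rewrite [X in is_dV _ X](is_dV_cderiv (du x)).
Qed.

Lemma CsmV_smooth u : CsmV u -> forall x, smooth (u x).
Proof.
move=> su x k t; have [_ /(_ x)/is_dVP/(_ t) h] := CsmV_cderivn k su.
by apply/cvg_ex; eexists; exact: h.
Qed.

Definition curve_family u (su : CsmV u) (x : T) : smooth_curve R n :=
  SmoothCurve (@CsmV_smooth u su x).

Lemma smooth_curve_is_dV (c : smooth_curve R n) k :
  is_dV (cderivn k c) (cderivn k.+1 c).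
Proof. by apply: cderiv_is_dV => t; exact: (@curve_smooth _ _ c k t). Qed.

Lemma Cinfty_derivn_continuous k : continuous (@Cinfty_derivn R n k).
Proof.
move=> c; have /cvg_sup/(_ k) h : nbhs c --> c by exact: cvg_id.
apply: cvg_trans (@initial_continuous _ _ (@Cinfty_derivn R n k) c).
by apply: cvg_app; exact: h.
Qed.

(** Half of e pays for the distance between the k-th derivatives of [c x] and [c y], uniform over
    [0, 1] by the topology; the other half pays for moving t along the single curve [c x]. *)
Lemma continuous_CsmV (c : T -> smooth_curve R n) :
  continuous c -> CsmV (fun x => c x).
Proof.
move=> cc; have jc k i : joint_continuous (fun x t => cderivn k (c x) t i 0).
  move=> [x t]; apply/cvgrPdist_lt => e e0 /=.
  have e2 : 0 < e / 2 by rewrite divr_gt0.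
  have kc : {for x, continuous (@Cinfty_derivn R n k \o c)}.
    by apply: continuous_comp; [exact: cc|exact: Cinfty_derivn_continuous].
  have : \forall y \near x, forall s, ball (cderivn k (c x) s) (e / 2) (cderivn k (c y) s).
    apply: (kc [set h : {uniform I01 R -> 'cV[R]_n.+1} |
      forall s, ball (cderivn k (c x) s) (e / 2) (h s)]).
    apply/uniform_nbhs; exists [set p | ball p.1 (e / 2) p.2]; split.
      exact: entourage_ball (PosNum e2).
    by move=> h hs s /=; exact: hs.
  have : \forall s \near t, `|cderivn k (c x) t i 0 - cderivn k (c x) s i 0| < e / 2.
    have dk : is_dV (cderivn k (c x)) (cderivn k.+1 (c x)) by exact: smooth_curve_is_dV.
    have dc : continuous (fun s => cderivn k (c x) s i 0) := is_d_continuous (dk i).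
    by move/cvgrPdist_lt: (dc t); exact.
  move=> ht hx; exists ([set y | forall s, ball (cderivn k (c x) s) (e / 2) (cderivn k (c y) s)],
    [set s | `|cderivn k (c x) t i 0 - cderivn k (c x) s i 0| < e / 2]); first by [].
  move=> [y s] /= [hy hs].
  have hys : ball (cderivn k (c x) s i 0) (e / 2) (cderivn k (c y) s i 0).
    by case: (hy s) => _; exact.
  rewrite (splitr e); apply: le_lt_trans (ltrD hs hys).
  by rewrite -[X in `|X|](subrKA (cderivn k (c x) s i 0)) ler_normD.
suff h m k i : Ck m (fun x t => cderivn k (c x) t i 0) by move=> i m; exact: (h m 0%N i).
elim: m k => [|m IH] k; split=> //; exists (fun x t => cderivn k.+1 (c x) t i 0) => // x.
exact: smooth_curve_is_dV.
Qed.

(** Joint continuity at each (x, t) controls the k-th derivative near t only; the tube lemma makes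
    the control uniform over [0, 1], which is what the topology asks. *)
Lemma CsmV_continuous (c : T -> smooth_curve R n) :
  CsmV (fun x => c x) -> continuous c.
Proof.
move=> sc x; apply/cvg_sup => k.
apply: (@continuous_comp_initial _ _ _ (@Cinfty_derivn R n k) c) => {}x.
have [/CsmV_joint jk _] := CsmV_cderivn k sc.
move=> A /uniform_nbhs[E [+ EA]]; rewrite -entourage_ballE => -[e /= e0 eE].
have e2 : 0 < e / 2 by rewrite divr_gt0.
have : \forall y \near x, forall t, ball (cderivn k (c x) t) e (cderivn k (c y) t).
  apply: (@near_tube _ _ [set p | ball (cderivn k (c x) p.2) e (cderivn k (c p.1) p.2)]) => t.
  have h : \forall p \near (x, t), ball (cderivn k (c x) t) (e / 2) (cderivn k (c p.1) p.2).
    by apply: (jk (x, t)); exact: nbhsx_ballx.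
  have [[U V] /= [Ux Vt] UV] := h; exists (U, V) => // -[y s] /= [Uy Vs].
  rewrite (splitr e); apply: (ball_triangle (ball_sym _) (UV (y, s) _)) => //.
  by apply: (UV (x, s)); split=> //=; exact: nbhs_singleton.
by apply: filterS => y hy; apply: EA => t _; apply: eE; exact: hy.
Qed.

End SmoothVectorFamilies.

(** * Lifts *)

Lemma cvg_sumr (R : realType) (U : Type) (F : set_system U) {FF : Filter F}
    (I : Type) (r : seq I) (f : I -> U -> R) (l : I -> R) :
  (forall i, f i x @[x --> F] --> l i) ->
  \sum_(i <- r) f i x @[x --> F] --> \sum_(i <- r) l i.
Proof.
move=> fl; elim: r => [|i r IH].
  by rewrite big_nil; under eq_fun => x do rewrite big_nil; exact: cvg_cst.
rewrite big_cons; under eq_fun => x do rewrite big_cons.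
by apply: cvgD; [exact: fl|exact: IH].
Qed.

Section UnitVectorFromProjector.
Context {R : realType} {n : nat}.
Implicit Types z y : I01 R -> 'cV[R]_n.

Lemma dotE (u v : 'cV[R]_n) : dot u v = \sum_i u i 0 * v i 0.
Proof. by rewrite /dot mxE; apply: eq_bigr => i _; rewrite mxE. Qed.

Lemma dotC (u v : 'cV[R]_n) : dot u v = dot v u.
Proof. by rewrite !dotE; apply: eq_bigr => i _; rewrite mulrC. Qed.

Lemma dotDl (u v w : 'cV[R]_n) : dot (u + v) w = dot u w + dot v w.
Proof. by rewrite /dot linearD /= mulmxDl mxE. Qed.

Lemma dotZl k (u v : 'cV[R]_n) : dot (k *: u) v = k * dot u v.
Proof. by rewrite /dot linearZ /= -scalemxAl mxE. Qed.

Lemma dotDr (u v w : 'cV[R]_n) : dot w (u + v) = dot w u + dot w v.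
Proof. by rewrite dotC dotDl !(dotC w). Qed.

Lemma dotZr k (u v : 'cV[R]_n) : dot u (k *: v) = k * dot u v.
Proof. by rewrite dotC dotZl dotC. Qed.

Lemma dotNl (u v : 'cV[R]_n) : dot (- u) v = - dot u v.
Proof. by rewrite -scaleN1r dotZl mulN1r. Qed.

Lemma dotNr (u v : 'cV[R]_n) : dot u (- v) = - dot u v.
Proof. by rewrite dotC dotNl dotC. Qed.

Lemma dot_delta_mx (u : 'cV[R]_n) j : dot u (delta_mx j 0) = u j 0.
Proof.
rewrite dotE (bigD1 j)//= mxE !eqxx mulr1 big1 ?addr0// => k kj.
by rewrite mxE (negPf kj) mulr0.
Qed.

Lemma cvg_dot (U : Type) (F : set_system U) {FF : Filter F}
    (f g : U -> 'cV[R]_n) (l m : 'cV[R]_n) :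
  (forall i, f x i 0 @[x --> F] --> l i 0) ->
  (forall i, g x i 0 @[x --> F] --> m i 0) ->
  dot (f x) (g x) @[x --> F] --> dot l m.
Proof.
move=> fl gm; rewrite dotE; under eq_fun => x do rewrite dotE.
by apply: cvg_sumr => i; apply: cvgM; [exact: fl|exact: gm].
Qed.

(** Squared Frobenius distance between the projectors u u^T and v v^T. *)
Definition proj_dist2 (u v : 'cV[R]_n) :=
  \sum_i \sum_j (u i 0 * u j 0 - v i 0 * v j 0) ^+ 2.

Lemma sum_proj (u v w x : 'cV[R]_n) :
  \sum_i \sum_j (u i 0 * v i 0) * (w j 0 * x j 0) = dot u v * dot w x.
Proof. by rewrite !dotE big_distrlr. Qed.

Lemma proj_dist2E (u v : 'cV[R]_n) : dot u u = 1 -> dot v v = 1 ->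
  proj_dist2 u v = 2 - 2 * dot u v ^+ 2.
Proof.
move=> u1 v1; have -> : proj_dist2 u v = dot u u * dot u u + dot v v * dot v v
    - 2 * (dot u v * dot u v).
  rewrite -!sum_proj mulr_sumr -!big_split -sumrN -big_split /=; apply: eq_bigr => i _.
  rewrite mulr_sumr -sumrN -!big_split /=; apply: eq_bigr => j _; ring.
by rewrite u1 v1; ring.
Qed.

(* <z, y>^2 = 1 - |zz^T - yy^T|^2 / 2 stays away from 0, so <z, y> keeps its initial sign. *)
Lemma dist_le_proj_dist z y :
  (forall i, continuous (fun t => z t i 0)) ->
  (forall i, continuous (fun t => y t i 0)) ->
  (forall t, dot (z t) (z t) = 1) -> (forall t, dot (y t) (y t) = 1) ->
  z (I01_start R) = y (I01_start R) ->
  (forall t, proj_dist2 (z t) (y t) < 1) ->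
  forall t, dot (z t - y t) (z t - y t) <= proj_dist2 (z t) (y t).
Proof.
move=> zc yc z1 y1 zy D1 t.
have c_gt0 s : 0 < dot (z s) (y s).
  apply: (@I01_nonvanishing_gt0 _ (fun s => dot (z s) (y s))) => [r||r].
  - by apply: (@cvg_dot _ (nbhs r)) => i; [exact: zc|exact: yc].
  - by rewrite zy y1.
  - apply/eqP => r0; have := D1 r; rewrite proj_dist2E// r0; lra.
(* With c = <z, y> positive, and at most 1 because |z - y|^2 = 2 - 2 c is nonnegative, 2 - 2 c is at
   most 2 - 2 c^2. *)
have := c_gt0 t; have := D1 t; rewrite proj_dist2E//.
have := dot_sqr_ge0 (z t - y t).
rewrite dotDl !dotDr !dotNl !dotNr z1 y1 (dotC (y t)); nra.
Qed.

(** The projector fixes a unit vector up to sign, and continuity from a common origin fixes the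
    sign: the preceding bound is applied at projector distance 0. *)
Lemma unit_proj_inj z y :
  (forall i, continuous (fun t => z t i 0)) ->
  (forall i, continuous (fun t => y t i 0)) ->
  (forall t, dot (z t) (z t) = 1) -> (forall t, dot (y t) (y t) = 1) ->
  z (I01_start R) = y (I01_start R) ->
  (forall t i j, z t i 0 * z t j 0 = y t i 0 * y t j 0) -> z = y.
Proof.
move=> zc yc z1 y1 zy p; apply/funext => t; apply/colP => i.
have D0 s : proj_dist2 (z s) (y s) = 0.
  by apply: big1 => j _; apply: big1 => k _; rewrite p subrr expr0n.
have D1 s : proj_dist2 (z s) (y s) < 1 by rewrite D0.
have := dist_le_proj_dist zc yc z1 y1 zy D1 t; rewrite D0 dotE => le0.
apply/eqP; rewrite -subr_eq0 -sqrf_eq0 eq_le sqr_ge0 andbT.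
apply: le_trans le0; rewrite (bigD1 i)//= !mxE -expr2 lerDl.
by apply: sumr_ge0 => j _; rewrite !mxE -expr2 sqr_ge0.
Qed.

Lemma is_d_sum (I : Type) (r : seq I) (f f' : I -> I01 R -> R) :
  (forall i, is_d (f i) (f' i)) ->
  is_d (fun t => \sum_(i <- r) f i t) (fun t => \sum_(i <- r) f' i t).
Proof.
move=> df t; rewrite [X in X @ _](_ : _ = fun s => \sum_(i <- r)
  (\val s - \val t)^-1 * (f i s - f i t)); last first.
  by apply/funext => s; rewrite -sumrB mulr_sumr.
by apply: cvg_sumr => i; exact: df.
Qed.

(** Let P = z z^T and c = <z s, z t>. Then (P s - P t) z t = c z s - z t, and <z t, (P s - P t) z t>
    = c^2 - 1. Subtracting (c^2 - 1) / (c + 1) times z s from the former leaves z s - z t, so the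
    difference quotient of z is expressed by that of P and by z itself, which is continuous. Near t
    the divisor c + 1 is nonzero, and its limit 2 gives the coefficient 1 / 2. *)
Lemma is_d_unit_proj z (p' : 'I_n -> 'I_n -> I01 R -> R) :
  (forall i, continuous (fun t => z t i 0)) -> (forall t, dot (z t) (z t) = 1) ->
  (forall i j, is_d (fun t => z t i 0 * z t j 0) (p' i j)) ->
  forall i, is_d (fun t => z t i 0) (fun t => \sum_j p' i j t * z t j 0 +
    - 2^-1 * (\sum_j \sum_k p' j k t * (z t j 0 * z t k 0)) * z t i 0).
Proof.
move=> zc z1 dp i t.
pose c s := dot (z s) (z t).
have cc : c s @[s --> t^'] --> (1 : R).
  rewrite -(z1 t); apply: (@cvg_dot _ t^') => j; last exact: cvg_cst.
  exact: (cvg_dnbhs (zc j)).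
have lim : \sum_j (\val s - \val t)^-1 * (z s i 0 * z s j 0 - z t i 0 * z t j 0) * z t j 0 -
    (\sum_j \sum_k (\val s - \val t)^-1 * (z s j 0 * z s k 0 - z t j 0 * z t k 0) *
       (z t j 0 * z t k 0)) * (c s + 1)^-1 * z s i 0 @[s --> t^'] -->
    \sum_j p' i j t * z t j 0 -
    (\sum_j \sum_k p' j k t * (z t j 0 * z t k 0)) * (1 + 1)^-1 * z t i 0.
  apply: cvgB.
    by apply: cvg_sumr => j; apply: cvgM; [exact: dp|exact: cvg_cst].
  apply: cvgM; last exact: (cvg_dnbhs (zc i)).
  apply: cvgM.
    apply: cvg_sumr => j; apply: cvg_sumr => k.
    by apply: cvgM; [exact: dp|exact: cvg_cst].
  by apply: cvgV; [rewrite gt_eqF|apply: cvgD => //; exact: cvg_cst].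
rewrite (_ : \sum_j _ + _ = \sum_j p' i j t * z t j 0 -
  (\sum_j \sum_k p' j k t * (z t j 0 * z t k 0)) * (1 + 1)^-1 * z t i 0); last first.
  by congr (_ + _); rewrite !mulNr; congr (- (_ * _)); rewrite mulrC.
apply: cvg_trans lim; apply: near_eq_cvg; near=> s.
have cs : c s + 1 != 0.
  rewrite gt_eqF//; have : 0 < c s by near: s; apply: (cvgr_gt 1) => //.
  by lra.
set k := (\val s - \val t)^-1.
have -> : \sum_j k * (z s i 0 * z s j 0 - z t i 0 * z t j 0) * z t j 0 =
    k * (z s i 0 * c s - z t i 0).
  rewrite -[X in _ - X]mulr1 -(z1 t) /c !dotE !mulr_sumr -sumrB mulr_sumr.
  by apply: eq_bigr => j _; ring.
have -> : \sum_j \sum_l k * (z s j 0 * z s l 0 - z t j 0 * z t l 0) *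
    (z t j 0 * z t l 0) = k * (c s * c s - 1).
  rewrite -[X in _ - X]mulr1 -{1 2}(z1 t) /c -!sum_proj -sumrB mulr_sumr.
  apply: eq_bigr => j _; rewrite -sumrB mulr_sumr.
  by apply: eq_bigr => l _; ring.
by field.
Unshelve. all: by end_near. Qed.

End UnitVectorFromProjector.

Section SmoothUnitVector.
Context {R : realType} {T : topologicalType} {n : nat}.

Lemma Ck_sum k (I : Type) (r : seq I) (u : I -> T -> I01 R -> R) :
  (forall i, Ck k (u i)) -> Ck k (fun x t => \sum_(i <- r) u i x t).
Proof.
move=> uk; elim: r => [|i r IH].
  rewrite (_ : (fun _ _ => _) = fun _ _ => 0); first exact: Ck_cst.
  by apply/funext => x; apply/funext => t; rewrite big_nil.
rewrite (_ : (fun _ _ => _) = fun x t => u i x t + \sum_(j <- r) u j x t).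
  exact: CkD.
by apply/funext => x; apply/funext => t; rewrite big_cons.
Qed.

Lemma Csm_sum (I : Type) (r : seq I) (u : I -> T -> I01 R -> R) :
  (forall i, Csm (u i)) -> Csm (fun x t => \sum_(i <- r) u i x t).
Proof. by move=> su k; apply: Ck_sum => i; exact: su. Qed.

Variable z : T -> I01 R -> 'cV[R]_n.
Hypothesis zc : forall x i, continuous (fun t => z x t i 0).
Hypothesis z1 : forall x t, dot (z x t) (z x t) = 1.
Hypothesis z0 : forall x y, z x (I01_start R) = z y (I01_start R).
Hypothesis sp : forall i j, Csm (fun x t => z x t i 0 * z x t j 0).

(** Continuity in x comes from the projectors: the tube lemma makes them close for all t at once,
    and [dist_le_proj_dist] carries this to z. Continuity in t at the fixed x does the rest. *)
Lemma unit_proj_joint_continuous i : joint_continuous (fun x t => z x t i 0).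
Proof.
move=> [x t]; apply/cvgrPdist_lt => e e0 /=.
have e2 : 0 < e / 2 by rewrite divr_gt0.
(* The bound 1 is the smallness required by [dist_le_proj_dist]; (e / 2)^2 appears because
   [proj_dist2] bounds a squared norm. *)
have d0 : 0 < Num.min 1 ((e / 2) ^+ 2) by rewrite lt_min ltr01 exprn_gt0.
have : \forall y \near x, forall s, proj_dist2 (z y s) (z x s) < Num.min 1 ((e / 2) ^+ 2).
  apply: (@near_tube _ _
    [set p | proj_dist2 (z p.1 p.2) (z x p.2) < Num.min 1 ((e / 2) ^+ 2)]) => s.
  have : proj_dist2 (z p.1 p.2) (z x p.2) @[p --> (x, s)] --> (0 : R).
    have -> : (0 : R) = \sum_(i < n) \sum_(j < n)
        (z x s i 0 * z x s j 0 - z x s i 0 * z x s j 0) ^+ 2.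
      by rewrite big1// => j _; rewrite big1// => k _; rewrite subrr expr0n.
    apply: cvg_sumr => j; apply: cvg_sumr => k.
    have jc : joint_continuous (fun x t => z x t j 0 * z x t k 0).
      exact: Ck_joint (sp j k 0%N).
    have sc : z x p.2 j 0 * z x p.2 k 0 @[p --> (x, s)] --> z x s j 0 * z x s k 0.
      apply: (@cvg_comp _ _ _ snd (fun s => z x s j 0 * z x s k 0) _ (nbhs s)).
        exact: cvg_snd.
      by apply: cvgM; exact: zc.
    by apply: cvgM; apply: cvgB => //; exact: (jc (x, s)).
  by move=> /cvgr_lt; exact.
have : \forall s \near t, `|z x t i 0 - z x s i 0| < e / 2.
  by move/cvgrPdist_lt: (@zc x i t); exact.
move=> ht hx; exists ([set y | forall s, proj_dist2 (z y s) (z x s) < Num.min 1 ((e / 2) ^+ 2)],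
    [set s | `|z x t i 0 - z x s i 0| < e / 2]); first by [].
move=> [y s] /= [hy hs].
have D1 r : proj_dist2 (z y r) (z x r) < 1.
  by apply: lt_le_trans (hy r) _; rewrite ge_min lexx.
have := dist_le_proj_dist (@zc y) (@zc x) (z1 y) (z1 x) (z0 y x) D1 s.
move=> /le_lt_trans/(_ (hy s)); rewrite lt_min => /andP[_ hD].
have : `|z x s i 0 - z y s i 0| < e / 2.
  rewrite -(ltr_pXn2r (_ : 0 < 2)%N)// ?nnegrE ?(ltW e2)//.
  apply: le_lt_trans hD; rewrite real_normK ?num_real// dotE (bigD1 i)//= !mxE.
  rewrite -opprB sqrrN -expr2 lerDl.
  by apply: sumr_ge0 => j _; rewrite !mxE -expr2 sqr_ge0.
move=> hys; rewrite (splitr e); apply: le_lt_trans (ltrD hs hys).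
by rewrite -[X in `|X|](subrKA (z x s i 0)) ler_normD.
Qed.

(** Bootstrap: the derivative of z is polynomial in z and in the derivatives of the projector, so
    order k for z gives order k + 1. *)
Lemma CsmV_unit_proj : CsmV z.
Proof.
have /choice[p' p'P] (ij : 'I_n * 'I_n) : exists p' : T -> I01 R -> R,
    (forall x, is_d (fun t => z x t ij.1 0 * z x t ij.2 0) (p' x)) /\ Csm p'.
  by have [q dq sq] := Csm_d (sp ij.1 ij.2); exists q.
suff h k i : Ck k (fun x t => z x t i 0) by move=> i k; exact: h.
elim: k i => [|k IH] i; (split; first exact: unit_proj_joint_continuous) => //.
exists (fun x t => \sum_j p' (i, j) x t * z x t j 0 +
    - 2^-1 * (\sum_j \sum_k p' (j, k) x t * (z x t j 0 * z x t k 0)) * z x t i 0).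
  move=> x; apply: (@is_d_unit_proj _ _ (z x) (fun i j => p' (i, j) x)) => //.
  by move=> j l; exact: (p'P (j, l)).1.
have p'k ij : Ck k (p' ij) by exact: (p'P ij).2.
apply: CkD; first by apply: Ck_sum => j; exact: CkM.
apply: CkM => //; apply: CkM; first exact: Ck_cst.
by apply: Ck_sum => j; apply: Ck_sum => l; apply: CkM => //; exact: CkM.
Qed.

End SmoothUnitVector.

(** * Leibniz rules and smoothness for vector and quaternion operations *)

Section BilinearSmooth.
Context {R : realType}.

Lemma is_dV_eq n (f g h : I01 R -> 'cV[R]_n) : is_dV f g -> g = h -> is_dV f h.
Proof. by move=> ? <-. Qed.

Lemma is_dVZ n (k k' : I01 R -> R) (f f' : I01 R -> 'cV[R]_n) :
  is_d k k' -> is_dV f f' ->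
  is_dV (fun t => k t *: f t) (fun t => k' t *: f t + k t *: f' t).
Proof.
move=> dk df i; rewrite (_ : (fun _ => _) = fun t => k t * f t i 0).
  apply: is_d_eq; first exact: is_dM.
  by apply/funext => t; rewrite !mxE.
by apply/funext => t; rewrite !mxE.
Qed.

Lemma is_d_dot n (f f' g g' : I01 R -> 'cV[R]_n) : is_dV f f' -> is_dV g g' ->
  is_d (fun t => dot (f t) (g t)) (fun t => dot (f' t) (g t) + dot (f t) (g' t)).
Proof.
move=> df dg; rewrite (_ : (fun _ => _) = fun t => \sum_i f t i 0 * g t i 0).
  apply: is_d_eq; first by apply: is_d_sum => i; exact: is_dM.
  by apply/funext => t; rewrite !dotE -big_split.
by apply/funext => t; rewrite dotE.
Qed.

Section Bilinear.
Context {m n p : nat} (B : 'cV[R]_m -> 'cV[R]_n -> 'cV[R]_p).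
Hypothesis BDl : forall u v w, B (u + v) w = B u w + B v w.
Hypothesis BDr : forall u v w, B u (v + w) = B u v + B u w.
Hypothesis BZl : forall k u v, B (k *: u) v = k *: B u v.
Hypothesis BZr : forall k u v, B u (k *: v) = k *: B u v.

(** In coordinates a bilinear map is a polynomial with constant coefficients, so its Leibniz rule
    and the smoothness of its values reduce to the scalar rules. The instance used is the quaternion
    product. *)
Lemma bilinear_sum u v i :
  B u v i 0 = \sum_j \sum_k u j 0 * v k 0 * B (delta_mx j 0) (delta_mx k 0) i 0.
Proof.
have B0l w : B 0 w = 0 by have := BZl 0 0 w; rewrite !scale0r.
have B0r w : B w 0 = 0 by have := BZr 0 w 0; rewrite !scale0r.
rewrite [in LHS](matrix_sum_delta u) (big_morph (B^~ v) (fun x y => BDl x y v) (B0l v)).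
rewrite summxE; apply: eq_bigr => j _; rewrite big_ord1 BZl mxE.
rewrite [in LHS](matrix_sum_delta v) (big_morph (B _) (BDr _) (B0r _)).
rewrite summxE mulr_sumr; apply: eq_bigr => k _.
by rewrite big_ord1 BZr mxE mulrA.
Qed.

Lemma is_dV_bilinear (u u' : I01 R -> 'cV[R]_m) (v v' : I01 R -> 'cV[R]_n) :
  is_dV u u' -> is_dV v v' ->
  is_dV (fun t => B (u t) (v t)) (fun t => B (u' t) (v t) + B (u t) (v' t)).
Proof.
move=> du dv i; rewrite (_ : (fun _ => _) = fun t =>
    \sum_j \sum_k u t j 0 * v t k 0 * B (delta_mx j 0) (delta_mx k 0) i 0); last first.
  by apply/funext => t; exact: bilinear_sum.
apply: is_d_eq.
  apply: is_d_sum => j; apply: is_d_sum => k; apply: is_dM; last exact: is_d_cst.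
  exact: is_dM.
apply/funext => t; rewrite mxE !bilinear_sum -big_split; apply: eq_bigr => j _.
by rewrite -big_split; apply: eq_bigr => k _ /=; rewrite mulr0 addr0 mulrDl.
Qed.

Lemma CsmV_bilinear (T : topologicalType) (u : T -> I01 R -> 'cV[R]_m)
    (v : T -> I01 R -> 'cV[R]_n) :
  CsmV u -> CsmV v -> CsmV (fun x t => B (u x t) (v x t)).
Proof.
move=> su sv i; rewrite (_ : (fun _ _ => _) = fun x t =>
    \sum_j \sum_k u x t j 0 * v x t k 0 * B (delta_mx j 0) (delta_mx k 0) i 0); last first.
  by apply/funext => x; apply/funext => t; exact: bilinear_sum.
apply: Csm_sum => j; apply: Csm_sum => k; apply: CsmM; last exact: Csm_cst.
by apply: CsmM; [exact: su|exact: sv].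
Qed.

End Bilinear.

Section Linear.
Context {m p : nat} (L : 'cV[R]_m -> 'cV[R]_p).
Hypothesis LD : forall u v, L (u + v) = L u + L v.
Hypothesis LZ : forall k u, L (k *: u) = k *: L u.

Lemma linear_sum u i : L u i 0 = \sum_j u j 0 * L (delta_mx j 0) i 0.
Proof.
have L0 : L 0 = 0 by have := LZ 0 0; rewrite !scale0r.
rewrite [in LHS](matrix_sum_delta u) (big_morph L LD L0).
by rewrite summxE; apply: eq_bigr => j _; rewrite big_ord1 LZ mxE.
Qed.

Lemma is_dV_linear (u u' : I01 R -> 'cV[R]_m) :
  is_dV u u' -> is_dV (fun t => L (u t)) (fun t => L (u' t)).
Proof.
move=> du i; rewrite (_ : (fun _ => _) = fun t =>
    \sum_j u t j 0 * L (delta_mx j 0) i 0); last first.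
  by apply/funext => t; exact: linear_sum.
apply: is_d_eq; first by apply: is_d_sum => j; apply: is_dM; last exact: is_d_cst.
apply/funext => t; rewrite linear_sum; apply: eq_bigr => j _.
by rewrite mulr0 addr0.
Qed.

Lemma CsmV_linear (T : topologicalType) (u : T -> I01 R -> 'cV[R]_m) :
  CsmV u -> CsmV (fun x t => L (u x t)).
Proof.
move=> su i; rewrite (_ : (fun _ _ => _) = fun x t =>
    \sum_j u x t j 0 * L (delta_mx j 0) i 0); last first.
  by apply/funext => x; apply/funext => t; exact: linear_sum.
by apply: Csm_sum => j; apply: CsmM; [exact: su|exact: Csm_cst].
Qed.

End Linear.

Lemma is_dV_cst n (w : 'cV[R]_n) : is_dV (fun=> w) (fun=> 0).
Proof.
by move=> i; apply: is_d_eq; [exact: is_d_cst|apply/funext => t; rewrite mxE].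
Qed.

End BilinearSmooth.

Section SmoothOperations.
Context {R : realType}.

Lemma qconjD (p q : 'cV[R]_(1 + 3)) : qconj (p + q) = qconj p + qconj q.
Proof.
quat4_coords p; quat4_coords q.
by rewrite !quat4_simpl; congr quat4; ring.
Qed.

Lemma qconjZ k (p : 'cV[R]_(1 + 3)) : qconj (k *: p) = k *: qconj p.
Proof. by quat4_coords p; rewrite !quat4_simpl; congr quat4; ring. Qed.

Lemma qimD (p q : 'cV[R]_(1 + 3)) : qim (p + q) = qim p + qim q.
Proof. by rewrite -{1}(QuatK p) -{1}(QuatK q) Quat_add Quat_qim. Qed.

Lemma qimZ k (p : 'cV[R]_(1 + 3)) : qim (k *: p) = k *: qim p.
Proof. by rewrite -{1}(QuatK p) Quat_scale Quat_qim. Qed.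

Lemma crossE (u v : 'cV[R]_3) : cross u v = qim (qmul (Quat 0 u) (Quat 0 v)).
Proof. by rewrite qmul_Quat0 Quat_qim. Qed.

Lemma is_dV_qmul (p p' q q' : I01 R -> 'cV[R]_(1 + 3)) : is_dV p p' -> is_dV q q' ->
  is_dV (fun t => qmul (p t) (q t)) (fun t => qmul (p' t) (q t) + qmul (p t) (q' t)).
Proof.
apply: is_dV_bilinear => *;
  [exact: qmulDl|exact: qmulDr|exact: qmulZl|exact: qmulZr].
Qed.

Lemma is_dV_qconj (p p' : I01 R -> 'cV[R]_(1 + 3)) : is_dV p p' ->
  is_dV (fun t => qconj (p t)) (fun t => qconj (p' t)).
Proof. by apply: is_dV_linear => *; [exact: qconjD|exact: qconjZ]. Qed.

Lemma is_dV_qim (p p' : I01 R -> 'cV[R]_(1 + 3)) : is_dV p p' ->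
  is_dV (fun t => qim (p t)) (fun t => qim (p' t)).
Proof. by apply: is_dV_linear => *; [exact: qimD|exact: qimZ]. Qed.

Lemma is_dV_Quat0 (u u' : I01 R -> 'cV[R]_3) : is_dV u u' ->
  is_dV (fun t => Quat 0 (u t)) (fun t => Quat 0 (u' t)).
Proof. by apply: is_dV_linear => *; [exact: Quat0D|exact: Quat0Z]. Qed.

Section Families.
Context {T : topologicalType}.

Lemma CsmV_qmul (p q : T -> I01 R -> 'cV[R]_(1 + 3)) :
  CsmV p -> CsmV q -> CsmV (fun x t => qmul (p x t) (q x t)).
Proof.
apply: CsmV_bilinear => *;
  [exact: qmulDl|exact: qmulDr|exact: qmulZl|exact: qmulZr].
Qed.

Lemma CsmV_qconj (p : T -> I01 R -> 'cV[R]_(1 + 3)) :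
  CsmV p -> CsmV (fun x t => qconj (p x t)).
Proof. by apply: CsmV_linear => *; [exact: qconjD|exact: qconjZ]. Qed.

Lemma CsmV_qim (p : T -> I01 R -> 'cV[R]_(1 + 3)) :
  CsmV p -> CsmV (fun x t => qim (p x t)).
Proof. by apply: CsmV_linear => *; [exact: qimD|exact: qimZ]. Qed.

Lemma CsmV_Quat0 (u : T -> I01 R -> 'cV[R]_3) :
  CsmV u -> CsmV (fun x t => Quat 0 (u x t)).
Proof. by apply: CsmV_linear => *; [exact: Quat0D|exact: Quat0Z]. Qed.

Lemma CsmV_cross (u v : T -> I01 R -> 'cV[R]_3) :
  CsmV u -> CsmV v -> CsmV (fun x t => cross (u x t) (v x t)).
Proof.
move=> su sv; rewrite (_ : (fun _ _ => _) = fun x t =>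
    qim (qmul (Quat 0 (u x t)) (Quat 0 (v x t)))).
  by apply: CsmV_qim; apply: CsmV_qmul; exact: CsmV_Quat0.
by apply/funext => x; apply/funext => t; rewrite crossE.
Qed.

Lemma CsmV_cst n (w : 'cV[R]_n) : CsmV (fun (_ : T) _ => w).
Proof. by move=> i; exact: Csm_cst. Qed.

Lemma CsmVD n (u v : T -> I01 R -> 'cV[R]_n) :
  CsmV u -> CsmV v -> CsmV (fun x t => u x t + v x t).
Proof.
move=> su sv i; rewrite (_ : (fun _ _ => _) = fun x t => u x t i 0 + v x t i 0).
  by apply: CsmD; [exact: su|exact: sv].
by apply/funext => x; apply/funext => t; rewrite mxE.
Qed.

Lemma CsmVZ n (k : T -> I01 R -> R) (v : T -> I01 R -> 'cV[R]_n) :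
  Csm k -> CsmV v -> CsmV (fun x t => k x t *: v x t).
Proof.
move=> sk sv i; rewrite (_ : (fun _ _ => _) = fun x t => k x t * v x t i 0).
  by apply: CsmM; [exact: sk|exact: sv].
by apply/funext => x; apply/funext => t; rewrite mxE.
Qed.

Lemma CsmVB n (u v : T -> I01 R -> 'cV[R]_n) :
  CsmV u -> CsmV v -> CsmV (fun x t => u x t - v x t).
Proof.
move=> su sv; rewrite (_ : (fun _ _ => _) = fun x t => u x t + (-1) *: v x t).
  by apply: CsmVD => //; apply: CsmVZ => //; exact: Csm_cst.
by apply/funext => x; apply/funext => t; rewrite scaleN1r.
Qed.

Lemma Csm_dot n (u v : T -> I01 R -> 'cV[R]_n) :
  CsmV u -> CsmV v -> Csm (fun x t => dot (u x t) (v x t)).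
Proof.
move=> su sv; rewrite (_ : (fun _ _ => _) = fun x t => \sum_i u x t i 0 * v x t i 0).
  by apply: Csm_sum => i; apply: CsmM; [exact: su|exact: sv].
by apply/funext => x; apply/funext => t; rewrite dotE.
Qed.

End Families.

(** Conjugation by a unit z is multiplicative, and the cross product is the imaginary part of a
    product of imaginary quaternions; the real part stays real under conjugation and [qim] drops
    it. *)
Lemma rot3_cross (z : 'cV[R]_(1 + 3)) u v : dot z z = 1 ->
  rot3 z (cross u v) = cross (rot3 z u) (rot3 z v).
Proof.
move=> z1; rewrite [RHS]crossE (Quat_rot3 z u) (Quat_rot3 z v).
have -> : qmul (rot4 z z (Quat 0 u)) (rot4 z z (Quat 0 v)) =
    rot4 z z (qmul (Quat 0 u) (Quat 0 v)).
  rewrite /rot4 !qmulA -(qmulA _ (qconj z) z) qmul_conjq z1 scale1r.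
  by rewrite qmulq1.
rewrite qmul_Quat0.
have -> : Quat (- dot u v) (cross u v) = (- dot u v) *: qone + Quat 0 (cross u v).
  by rewrite /qone /quat4 Quat_scale Quat_add mulr1 addr0 -vec3_0 scaler0 add0r.
rewrite rot4D rot4Z qimD qimZ.
have -> : qim (rot4 z z qone) = 0.
  by rewrite /rot4 qmulq1 qmulq_conj qimZ /qone /quat4 Quat_qim -vec3_0 scaler0.
by rewrite scaler0 add0r.
Qed.

(* Follows from [sum_e e w e^* = 4 Re w] over the basis 1, i, j, k, applied to w = z^* u. *)
Lemma dot_scale_rot4 (z u : 'cV[R]_(1 + 3)) :
  dot z u *: z = 4^-1 *: (qmul (qmul (rot4 z z qone) u) (qconj qone) +
    qmul (qmul (rot4 z z qi) u) (qconj qi) + qmul (qmul (rot4 z z qj) u) (qconj qj) +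
    qmul (qmul (rot4 z z qk) u) (qconj qk)).
Proof.
rewrite /rot4 /qone /qi /qj /qk; quat4_coords z; quat4_coords u.
by rewrite !quat4_simpl; congr quat4; field.
Qed.

Lemma spin3_continuous (z : I01 R -> spin3 R) (i : 'I_(1 + 3)) :
  continuous z -> continuous (fun t => \val (z t) i 0).
Proof.
move=> zc t; apply: (@continuous_comp _ _ _ (\val \o z) (fun q : 'cV[R]_(1 + 3) => q i 0)).
  by apply: continuous_comp; [exact: zc|exact: initial_continuous].
exact: coord_continuous.
Qed.

Definition ve1 : 'cV[R]_3 := vec3 1 0 0.
Definition ve2 : 'cV[R]_3 := vec3 0 1 0.
Definition ve3 : 'cV[R]_3 := vec3 0 0 1.

Lemma cross_ve12 : cross ve1 ve2 = ve3.
Proof. by rewrite /ve1 /ve2 !vec3_simpl; congr vec3; ring. Qed.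

Lemma rot3_ve3 (z : 'cV[R]_(1 + 3)) : dot z z = 1 ->
  rot3 z ve3 = cross (rot3 z ve1) (rot3 z ve2).
Proof.
move=> z1; exact: (etrans (congr1 (rot3 z) (esym cross_ve12)) (rot3_cross ve1 ve2 z1)).
Qed.

(** The third column of a rotation is the cross product of the first two. Entry (i, j) of z z^T is
    coordinate i of <z, e_j> z, which [dot_scale_rot4] writes through the rotated basis. *)
Lemma unit_proj_smooth (T : topologicalType) (z : T -> I01 R -> 'cV[R]_(1 + 3)) :
  (forall x t, dot (z x t) (z x t) = 1) ->
  CsmV (fun x t => rot3 (z x t) ve1) -> CsmV (fun x t => rot3 (z x t) ve2) ->
  forall i j, Csm (fun x t => z x t i 0 * z x t j 0).
Proof.
move=> z1 s1 s2 i j.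
have s3 : CsmV (fun x t => rot3 (z x t) ve3).
  under eq_fun => x do under eq_fun => t do rewrite rot3_ve3//.
  exact: CsmV_cross.
rewrite (_ : (fun _ _ => _) = fun x t => (dot (z x t) (delta_mx j 0) *: z x t) i 0).
  have s (u : 'cV[R]_3) : CsmV (fun x t => rot3 (z x t) u) ->
      CsmV (fun x t => rot4 (z x t) (z x t) (Quat 0 u)).
    move=> su; under eq_fun => x do under eq_fun => t do rewrite -Quat_rot3.
    exact: CsmV_Quat0.
  have s0 : CsmV (fun x t => rot4 (z x t) (z x t) qone).
    under eq_fun => x do under eq_fun => t do rewrite /rot4 qmulq1 qmulq_conj z1.
    exact: CsmV_cst.
  have h : CsmV (fun x t => dot (z x t) (delta_mx j 0) *: z x t).
    under eq_fun => x do under eq_fun => t do rewrite dot_scale_rot4.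
    apply: CsmVZ; first exact: Csm_cst.
    have r e : CsmV (fun x t => rot4 (z x t) (z x t) e) -> CsmV (fun x t =>
        qmul (qmul (rot4 (z x t) (z x t) e) (delta_mx j 0)) (qconj e)).
      move=> re; apply: CsmV_qmul; last exact: CsmV_cst.
      by apply: CsmV_qmul; [exact: re|exact: CsmV_cst].
    have rk := r qk (s ve3 s3); have rj := r qj (s ve2 s2); have ri := r qi (s ve1 s1).
    by apply: CsmVD rk; apply: CsmVD rj; apply: CsmVD ri; exact: r s0.
  exact: h.
by apply/funext => x; apply/funext => t; rewrite mxE dot_delta_mx mulrC.
Qed.

(** Lifts at different parameters are tied together only by their common origin and by the rotations
    they cover; the projectors turn the smoothness of these rotations into that of the lifts. *)
Lemma spin3_lift_smooth (T : topologicalType) (z : T -> I01 R -> spin3 R) :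
  (forall x, continuous (z x)) -> (forall x, z x (I01_start R) = one3 R) ->
  CsmV (fun x t => rot3 (\val (z x t)) ve1) ->
  CsmV (fun x t => rot3 (\val (z x t)) ve2) ->
  CsmV (fun x t => \val (z x t)).
Proof.
move=> zc z0 s1 s2; have z1 x t := spin3_unit (z x t).
apply: CsmV_unit_proj => [x i|//|x y|].
- exact: spin3_continuous.
- by rewrite !z0.
- exact: unit_proj_smooth.
Qed.

Lemma spin3_lift_unique (z y : I01 R -> spin3 R) : continuous z -> continuous y ->
  z (I01_start R) = y (I01_start R) ->
  (forall t, rot3 (\val (z t)) ve1 = rot3 (\val (y t)) ve1) ->
  (forall t, rot3 (\val (z t)) ve2 = rot3 (\val (y t)) ve2) -> z = y.
Proof.
move=> zc yc zy e1 e2.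
have z1 t := spin3_unit (z t); have y1 t := spin3_unit (y t).
suff h : (fun t => \val (z t)) = (fun t => \val (y t)).
  by apply/funext => t; apply: val_inj; exact: (congr1 (fun f => f t) h).
apply: unit_proj_inj => // [i|i||t i j]; [exact: spin3_continuous|
  exact: spin3_continuous|by rewrite zy|].
have e3 : rot3 (\val (z t)) ve3 = rot3 (\val (y t)) ve3.
  by rewrite (rot3_ve3 (z1 t)) (rot3_ve3 (y1 t)) e1 e2.
have entry (w : 'cV[R]_(1 + 3)) : w i 0 * w j 0 = (dot w (delta_mx j 0) *: w) i 0.
  by rewrite mxE dot_delta_mx mulrC.
rewrite !entry !dot_scale_rot4.
have -> : rot4 (\val (z t)) (\val (z t)) qone = rot4 (\val (y t)) (\val (y t)) qone.
  by rewrite /rot4 !qmulq1 !qmulq_conj z1 y1.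
by rewrite -!Quat_rot3 e1 e2 e3.
Qed.

(** The candidate is the imaginary part of z^* z'. The real part is <z, z'>, which vanishes because
    |z| = 1 is constant. *)
Lemma angular_velocity (T : topologicalType) (z : T -> I01 R -> 'cV[R]_(1 + 3)) :
  CsmV z -> (forall x t, dot (z x t) (z x t) = 1) ->
  exists2 a : T -> I01 R -> 'cV[R]_3, CsmV a &
    forall x, is_dV (z x) (fun t => qmul (z x t) (Quat 0 (a x t))).
Proof.
move=> sz z1; have [z' dz sz'] := CsmV_d sz.
exists (fun x t => qim (qmul (qconj (z x t)) (z' x t))).
  by apply: CsmV_qim; apply: CsmV_qmul => //; exact: CsmV_qconj.
move=> x; apply: is_dV_eq (dz x) _; apply/funext => t.
have zz' : dot (z x t) (z' x t) = 0.
  have dd := is_d_dot (dz x) (dz x).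
  have d0 : is_d (fun t => dot (z x t) (z x t)) (fun=> 0).
    by under eq_fun => s do rewrite z1; exact: is_d_cst.
  have := congr1 (fun f => f t) (is_d_unique dd d0) => /=.
  rewrite dotC; lra.
have re0 : qre (qmul (qconj (z x t)) (z' x t)) = 0.
  rewrite -zz'; move: (z x t) (z' x t) => p q; quat4_coords p; quat4_coords q.
  by rewrite !quat4_simpl Quat_qre; ring.
by rewrite -[X in Quat X _]re0 QuatK qmulA qmulq_conj z1 scale1r qmul1q.
Qed.

End SmoothOperations.

(** * Frenet frames *)

Section GramSchmidt.
Context {R : realType}.

Definition normalize n (w : 'cV[R]_n) := (enorm w)^-1 *: w.

Lemma normalizeP n (w e : 'cV[R]_n) : dot e e = 1 ->
  normalize w = e <-> exists2 c, 0 < c & w = c *: e.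
Proof.
move=> e1; split=> [we|[c c0 ->]].
  (* Since [0^-1] is 0, a vector of norm 0 would normalise to 0 and not to the unit vector e. *)
  have w0 : enorm w != 0.
    apply/eqP => w0; have /eqP := e1; rewrite -we /normalize w0 invr0 scale0r.
    by rewrite /dot mulmx0 mxE eq_sym oner_eq0.
  exists (enorm w); first by rewrite lt_neqAle eq_sym w0 sqrtr_ge0.
  by rewrite -we /normalize scalerA mulfV// scale1r.
rewrite /normalize /enorm dotZl dotZr e1 mulr1 -expr2 sqrtr_sqr gtr0_norm//.
by rewrite scalerA mulVf ?gt_eqF// scale1r.
Qed.

Lemma gram_schmidt_rcons n (vs : seq 'cV[R]_n) v :
  gram_schmidt (rcons vs v) = rcons (gram_schmidt vs)
    (normalize (v - \sum_(e <- gram_schmidt vs) dot v e *: e)).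
Proof. by rewrite /gram_schmidt foldl_rcons. Qed.

(** Uniqueness of the QR factorisation: the frame condition becomes a triangular system with
    positive diagonal, ready to be compared with derivatives written in the moving frame. *)
Lemma gram_schmidt2P n (v0 v1 e0 e1 : 'cV[R]_n) :
  dot e0 e0 = 1 -> dot e1 e1 = 1 -> dot e0 e1 = 0 ->
  gram_schmidt [:: v0; v1] = [:: e0; e1] <->
  exists c0 a c1, [/\ 0 < c0, 0 < c1, v0 = c0 *: e0 & v1 = a *: e0 + c1 *: e1].
Proof.
move=> e00 e11 e01; have e10 : dot e1 e0 = 0 by rewrite dotC.
rewrite -[[:: v0; v1]]/(rcons (rcons [::] v0) v1) !gram_schmidt_rcons /= big_nil subr0 big_seq1.
split.
  case=> /(normalizeP _ e00)[c0 c00 v0E].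
  have n0 : normalize v0 = e0 by apply/normalizeP => //; exists c0.
  rewrite n0 => /(normalizeP _ e11)[c1 c10 v1E].
  exists c0, (dot v1 e0), c1; split=> //.
  by rewrite -v1E addrC subrK.
move=> [c0 [a [c1 [c00 c10 -> ->]]]].
have n0 : normalize (c0 *: e0) = e0 by apply/normalizeP => //; exists c0.
have n1 : normalize (c1 *: e1) = e1 by apply/normalizeP => //; exists c1.
by rewrite n0 dotDl !dotZl e00 e10 mulr1 mulr0 addr0 addrAC subrr add0r n1.
Qed.

Lemma gram_schmidt3P n (v0 v1 v2 e0 e1 e2 : 'cV[R]_n) :
  dot e0 e0 = 1 -> dot e1 e1 = 1 -> dot e2 e2 = 1 ->
  dot e0 e1 = 0 -> dot e0 e2 = 0 -> dot e1 e2 = 0 ->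
  gram_schmidt [:: v0; v1; v2] = [:: e0; e1; e2] <->
  exists c0 a c1, exists b0 b1 c2, [/\ 0 < c0 /\ v0 = c0 *: e0,
    0 < c1 /\ v1 = a *: e0 + c1 *: e1 &
    0 < c2 /\ v2 = b0 *: e0 + b1 *: e1 + c2 *: e2].
Proof.
move=> e00 e11 e22 e01 e02 e12.
rewrite -[[:: v0; v1; v2]]/(rcons [:: v0; v1] v2) gram_schmidt_rcons.
rewrite -[[:: e0; e1; e2]]/(rcons [:: e0; e1] e2).
have S2 v : \sum_(e <- [:: e0; e1]) dot v e *: e = dot v e0 *: e0 + dot v e1 *: e1.
  by rewrite big_cons big_seq1.
split.
  move=> /eqP; rewrite eqseq_rcons => /andP[/eqP g /eqP].
  rewrite g S2 => /(normalizeP _ e22)[c2 c20 v2E].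
  have [c0 [a [c1 [c00 c10 v0E v1E]]]] := (gram_schmidt2P _ _ e00 e11 e01).1 g.
  exists c0, a, c1, (dot v2 e0), (dot v2 e1), c2; split=> //; split=> //.
  by rewrite -v2E addrC subrK.
move=> [c0 [a [c1 [b0 [b1 [c2 [[c00 v0E] [c10 v1E] [c20 ->]]]]]]]].
have g : gram_schmidt [:: v0; v1] = [:: e0; e1].
  by apply/gram_schmidt2P => //; exists c0, a, c1.
rewrite g S2 !dotDl !dotZl e00 e11 (dotC e1) e01 (dotC e2 e0) (dotC e2 e1) e02 e12.
rewrite !(mulr0, mulr1, addr0, add0r) addrAC subrr add0r; congr rcons.
by apply/normalizeP => //; exists c2.
Qed.

End GramSchmidt.

Section FrenetMatrix.
Context {R : realType}.

(** H = G^T F is orthogonal of determinant 1, and its first n columns are those of the identity.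
    Orthogonality to them clears the last column off the diagonal, and the determinant makes the
    remaining entry 1. *)
Lemma SO_last_col_unique n (F G : 'M[R]_n.+1) : SO R n.+1 F -> SO R n.+1 G ->
  (forall j : 'I_n, col (widen_ord (leqnSn n) j) F = col (widen_ord (leqnSn n) j) G) ->
  F = G.
Proof.
move=> [FF dF] [GG dG] e.
have GGt : G *m G^T = 1%:M by exact: mulmx1C.
have [H HE] : exists H, H = G^T *m F by eexists.
have HH : H^T *m H = 1%:M.
  by rewrite HE trmx_mul trmxK -mulmxA (mulmxA G) GGt mul1mx.
have dH : \det H = 1 by rewrite HE det_mulmx det_tr dF dG mulr1.
have Hl (j : 'I_n) i : H i (widen_ord (leqnSn n) j) = (i == widen_ord (leqnSn n) j)%:R.
  have := congr1 (fun M : 'M[R]_n.+1 => M i (widen_ord (leqnSn n) j)) GG; rewrite [in RHS]mxE => <-.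
  rewrite HE !mxE; apply: eq_bigr => k _; congr (_ * _).
  by have := congr1 (fun M : 'cV[R]_n.+1 => M k 0) (e j); rewrite !mxE.
have Hr (j : 'I_n) : H (widen_ord (leqnSn n) j) ord_max = 0.
  have := congr1 (fun M : 'M[R]_n.+1 => M (widen_ord (leqnSn n) j) ord_max) HH.
  rewrite !mxE (bigD1 (widen_ord (leqnSn n) j))//= !mxE.
  have -> : (widen_ord (leqnSn n) j == ord_max) = false.
    by apply/negbTE; rewrite -val_eqE /= neq_ltn ltn_ord.
  rewrite big1 => [|k kj]; last by rewrite mxE Hl (negPf kj) mul0r.
  by rewrite Hl eqxx mul1r addr0.
have Hoff i j : i != j -> H i j = 0.
  have [->|jn] := eqVneq j ord_max => ij.
    have il : (i < n)%N by rewrite ltn_neqAle -ltnS ltn_ord andbT.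
    by have := Hr (Ordinal il); congr (H _ _ = _); exact: val_inj.
  have jl : (j < n)%N by rewrite ltn_neqAle -ltnS ltn_ord andbT.
  have -> : j = widen_ord (leqnSn n) (Ordinal jl) by exact: val_inj.
  rewrite Hl; case: eqP => // ie; move: ij; rewrite ie; case/eqP; exact: val_inj.
have H1 : H = 1%:M.
  have Htrig : is_trig_mx H.
    by apply/is_trig_mxP => i j ij; apply: Hoff; rewrite -val_eqE neq_ltn ij.
  have Hd (j : 'I_n) : H (widen_ord (leqnSn n) j) (widen_ord (leqnSn n) j) = 1.
    by rewrite Hl eqxx.
  have Hn : H ord_max ord_max = 1.
    rewrite -[RHS]dH det_trig// big_ord_recr /= big1 ?mul1r// => j _.
  apply/matrixP => i j; rewrite [RHS]mxE.
  have [->|ij] := eqVneq i j; last exact: Hoff.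
  have [->|jn] := eqVneq j ord_max; first exact: Hn.
  have jl : (j < n)%N by rewrite ltn_neqAle -ltnS ltn_ord andbT.
  have -> : j = widen_ord (leqnSn n) (Ordinal jl) by exact: val_inj.
  exact: Hd.
by rewrite -[F]mul1mx -GGt -mulmxA -HE H1 mulmx1.
Qed.

(* A frame in SO(n+1) is not 0, so equality with it excludes the default value of [frenet]. *)
Lemma frenetP n (f : I01 R -> 'cV[R]_n.+1) t F : SO R n.+1 F ->
  frenet f t = F <->
  forall j : 'I_n, col (widen_ord (leqnSn n) j) F = (gram_schmidt (jet f t))`_j.
Proof.
move=> FSO; have [FF _] := FSO; rewrite /frenet.
set S := [set F | _]; split=> [FE|cF].
  have [SF|nS] := pselect (exists G, S G).
    by have := xgetPex 0 SF; rewrite FE => -[].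
  have F0 : F = 0 by rewrite -FE xgetPN// => G SG; apply: nS; exists G.
  have := congr1 (fun M : 'M[R]_n.+1 => M 0 0) FF.
  by rewrite F0 mulmx0 !mxE eqxx => /eqP; rewrite eq_sym oner_eq0.
have SF : S F by [].
have [GSO cG] := xgetPex 0 (ex_intro _ F SF).
by apply: SO_last_col_unique => // j; rewrite cG cF.
Qed.

End FrenetMatrix.

Section Frenet.
Context {R : realType}.

Lemma size_gram_schmidt n (vs : seq 'cV[R]_n) : size (gram_schmidt vs) = size vs.
Proof.
by elim/last_ind: vs => // vs v IH; rewrite gram_schmidt_rcons !size_rcons IH.
Qed.

Lemma delta_vec3 : [/\ delta_mx 0 0 = ve1 :> 'cV[R]_3, delta_mx 1 0 = ve2 :> 'cV[R]_3 &
  delta_mx 2%:R 0 = ve3 :> 'cV[R]_3].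
Proof. by split; rewrite [LHS]vec3E !mxE. Qed.

Lemma delta_quat4 : [/\ delta_mx 0 0 = qone :> 'cV[R]_(1 + 3),
  delta_mx 1 0 = qi :> 'cV[R]_(1 + 3), delta_mx 2%:R 0 = qj :> 'cV[R]_(1 + 3) &
  delta_mx 3%:R 0 = qk :> 'cV[R]_(1 + 3)].
Proof.
by split; apply/colP => i; rewrite quat4_entry mxE; case: i => -[|[|[|[|//]]]].
Qed.

Lemma dot_ve : [/\ dot ve1 ve1 = 1 :> R, dot ve2 ve2 = 1 :> R & dot ve1 ve2 = 0 :> R].
Proof. by rewrite /ve1 /ve2 !dot_vec3 !(mul0r, mulr0, mul1r, addr0, add0r). Qed.

Lemma dot_q : [/\ dot qone qone = 1 :> R, dot qi qi = 1 :> R & dot qj qj = 1 :> R] /\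
  [/\ dot qone qi = 0 :> R, dot qone qj = 0 :> R & dot qi qj = 0 :> R].
Proof.
by rewrite /qone /qi /qj !dot_quat4 !(mul0r, mulr0, mul1r, addr0, add0r).
Qed.

Lemma frenet_Pi3P (f : I01 R -> 'cV[R]_3) t (z : spin3 R) :
  frenet f t = Pi3 z <-> exists c0 a c1, [/\ 0 < c0, 0 < c1,
    f t = c0 *: rot3 (\val z) ve1 &
    cderiv f t = a *: rot3 (\val z) ve1 + c1 *: rot3 (\val z) ve2].
Proof.
have z1 := spin3_unit z; have [d1 d2 _] := delta_vec3; have [e11 e22 e12] := dot_ve.
have c0 : col (widen_ord (leqnSn 2) 0) (Pi3 z) = rot3 (\val z) ve1.
  by rewrite Pi3E col_mx_of -d1; congr (rot3 _ (delta_mx _ _)); exact: val_inj.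
have c1 : col (widen_ord (leqnSn 2) 1) (Pi3 z) = rot3 (\val z) ve2.
  by rewrite Pi3E col_mx_of -d2; congr (rot3 _ (delta_mx _ _)); exact: val_inj.
rewrite (frenetP _ _ (Pi3_SO z)) -gram_schmidt2P ?dot_rot3//.
split=> [h|e j]; last first.
  rewrite [jet f t](_ : _ = [:: f t; cderiv f t])// e.
  by case: (unliftP 0 j) => [k ->|->]; rewrite ?ord1 /= -?c0 -?c1//;
    congr (col _ _); exact: val_inj.
apply: (@eq_from_nth _ 0) => [|i]; rewrite size_gram_schmidt //=.
case: i => [_|[_|//]]; [have := h 0|have := h 1]; by rewrite ?c0 ?c1 => ->.
Qed.

Lemma frenet_Pi4P (f : I01 R -> 'cV[R]_4) t (z : spin4 R) :
  frenet f t = Pi4 z <-> exists c0 a c1, exists b0 b1 c2, [/\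
    0 < c0 /\ f t = c0 *: rot4 (\val z.1) (\val z.2) qone,
    0 < c1 /\ cderiv f t = a *: rot4 (\val z.1) (\val z.2) qone +
      c1 *: rot4 (\val z.1) (\val z.2) qi &
    0 < c2 /\ cderiv (cderiv f) t = b0 *: rot4 (\val z.1) (\val z.2) qone +
      b1 *: rot4 (\val z.1) (\val z.2) qi + c2 *: rot4 (\val z.1) (\val z.2) qj].
Proof.
have z1 := spin3_unit z.1; have z2 := spin3_unit z.2.
have [d0 d1 d2 _] := delta_quat4; have [[e00 e11 e22] [e01 e02 e12]] := dot_q.
have c0 : col (widen_ord (leqnSn 3) 0) (Pi4 z) = rot4 (\val z.1) (\val z.2) qone.
  by rewrite Pi4E col_mx_of -d0; congr (rot4 _ _ (delta_mx _ _)); exact: val_inj.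
have c1 : col (widen_ord (leqnSn 3) 1) (Pi4 z) = rot4 (\val z.1) (\val z.2) qi.
  by rewrite Pi4E col_mx_of -d1; congr (rot4 _ _ (delta_mx _ _)); exact: val_inj.
have c2 : col (widen_ord (leqnSn 3) 2%:R) (Pi4 z) = rot4 (\val z.1) (\val z.2) qj.
  by rewrite Pi4E col_mx_of -d2; congr (rot4 _ _ (delta_mx _ _)); exact: val_inj.
rewrite (frenetP _ _ (Pi4_SO z)) -gram_schmidt3P ?dot_rot4//.
split=> [h|e j]; last first.
  rewrite [jet f t](_ : _ = [:: f t; cderiv f t; cderiv (cderiv f) t])// e.
  have [->|[->|->]] : j = 0 \/ j = 1 \/ j = 2%:R.
    case: j => -[|[|[|//]]] ?; [left|right; left|right; right]; exact: val_inj.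
  - exact: c0.
  - exact: c1.
  - exact: c2.
apply: (@eq_from_nth _ 0) => [|i]; rewrite size_gram_schmidt //=.
case: i => [_|[_|[_|//]]]; [have := h 0|have := h 1|have := h 2%:R];
  by rewrite ?c0 ?c1 ?c2 => ->.
Qed.

End Frenet.

(** * Derivatives in a moving frame *)

Section MovingFrames.
Context {R : realType}.

Lemma is_dV_quat4 (a b c d a' b' c' d' : I01 R -> R) :
  is_d a a' -> is_d b b' -> is_d c c' -> is_d d d' ->
  is_dV (fun t => quat4 (a t) (b t) (c t) (d t))
        (fun t => quat4 (a' t) (b' t) (c' t) (d' t)).
Proof.
move=> da db dc dd [[|[|[|[|//]]]] i].
- rewrite (_ : (fun _ => _) = a); last by apply/funext => t; rewrite quat4_entry.
  by apply: is_d_eq da _; apply/funext => t; rewrite quat4_entry.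
- rewrite (_ : (fun _ => _) = b); last by apply/funext => t; rewrite quat4_entry.
  by apply: is_d_eq db _; apply/funext => t; rewrite quat4_entry.
- rewrite (_ : (fun _ => _) = c); last by apply/funext => t; rewrite quat4_entry.
  by apply: is_d_eq dc _; apply/funext => t; rewrite quat4_entry.
- rewrite (_ : (fun _ => _) = d); last by apply/funext => t; rewrite quat4_entry.
  by apply: is_d_eq dd _; apply/funext => t; rewrite quat4_entry.
Qed.

(** Velocity read in the moving frame: a stands to the right of z, hence acts inside z q y^* next to
    q. *)
Definition angular (z : I01 R -> 'cV[R]_(1 + 3)) (a : I01 R -> 'cV[R]_3) :=
  is_dV z (fun t => qmul (z t) (Quat 0 (a t))).

(** Leibniz rule on z q y^*; the minus sign is the conjugate of the imaginary b. *)
Lemma is_dV_rot4 z y a b (q q' : I01 R -> 'cV[R]_(1 + 3)) :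
  angular z a -> angular y b -> is_dV q q' ->
  is_dV (fun t => rot4 (z t) (y t) (q t))
    (fun t => rot4 (z t) (y t)
      (q' t + qmul (Quat 0 (a t)) (q t) - qmul (q t) (Quat 0 (b t)))).
Proof.
move=> dz dy dq.
apply: is_dV_eq (is_dV_qmul (is_dV_qmul dz dq) (is_dV_qconj dy)) _.
apply/funext => t; move: (z t) (y t) (a t) (b t) (q t) (q' t).
move=> {dz dy dq} {}z {}y {}a {}b {}q {}q'.
rewrite qconjM qconj_Quat0 /rot4.
have [? [? [? [? ->]]]] := quat4_ex (Quat 0 a).
have [? [? [? [? ->]]]] := quat4_ex (Quat 0 b).
quat4_coords z; quat4_coords y; quat4_coords q; quat4_coords q'.
by rewrite !quat4_simpl; congr quat4; ring.
Qed.

(** The case of two equal factors: the commutator a u - u a of imaginary quaternions is 2 a x u, the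
    origin of every factor 2 in the formulas on S^2. *)
Lemma is_dV_rot3 z a (u u' : I01 R -> 'cV[R]_3) : angular z a -> is_dV u u' ->
  is_dV (fun t => rot3 (z t) (u t)) (fun t => rot3 (z t) (u' t + 2 *: cross (a t) (u t))).
Proof.
move=> dz du.
apply: is_dV_eq (is_dV_qim (is_dV_rot4 dz dz (is_dV_Quat0 du))) _.
apply/funext => t; congr (qim (rot4 _ _ _)).
move: (a t) (u t) (u' t) => x y w; rewrite !qmul_Quat0 -addrA.
rewrite Quat_opp !Quat_add [x in Quat x](_ : _ = 0); last by rewrite dotC; ring.
congr (Quat 0 (_ + _)); rewrite (vec3E x) (vec3E y) !vec3_simpl; congr vec3; ring.
Qed.

End MovingFrames.

(** * Curves on the spheres *)

Section SphericalCurves.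
Context {R : realType}.

Lemma rot3_inj (z : 'cV[R]_(1 + 3)) : dot z z = 1 -> injective (rot3 z).
Proof.
move=> z1 u v uv; apply: Quat0_inj; have := congr1 (Quat 0) uv.
rewrite (Quat_rot3 z u) (Quat_rot3 z v) /rot4 => /(congr1 (qmul (qconj z))) /(congr1 (qmul^~ z)).
rewrite !qmulA qmul_conjq z1 !scale1r !qmul1q -!qmulA qmul_conjq z1 scale1r !qmulq1.
exact.
Qed.

Lemma rot4_inj (z y : 'cV[R]_(1 + 3)) : dot z z = 1 -> dot y y = 1 -> injective (rot4 z y).
Proof.
move=> z1 y1 p q; rewrite /rot4 => /(congr1 (qmul (qconj z))) /(congr1 (qmul^~ y)).
rewrite !qmulA qmul_conjq z1 !scale1r !qmul1q -!qmulA qmul_conjq y1 scale1r !qmulq1.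
exact.
Qed.

Lemma vec3_inj (a b c a' b' c' : R) : vec3 a b c = vec3 a' b' c' ->
  [/\ a = a', b = b' & c = c'].
Proof.
by move=> /colP e; move: (e 0) (e 1) (e 2%:R); rewrite !mxE.
Qed.

(** Serves the convexity determinants: in frame coordinates the successive derivatives are upper
    triangular, and passing to these coordinates is a rotation. *)
Lemma det_upper n (w : 'I_n -> 'cV[R]_n) (M : 'M[R]_n) (v : 'I_n -> 'cV[R]_n) :
  \det M = 1 -> (forall k, v k = M *m w k) ->
  (forall i k : 'I_n, (k < i)%N -> w k i 0 = 0) ->
  \det (\matrix_(i, k) v k i 0) = \prod_i w i i 0.
Proof.
move=> M1 vw up.
have -> : \matrix_(i, k) v k i 0 = M *m \matrix_(i, k) w k i 0.
  apply/matrixP => i k; rewrite !mxE vw !mxE; apply: eq_bigr => j _.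
  by rewrite !mxE.
rewrite det_mulmx M1 mul1r -det_tr det_trig.
  by apply: eq_bigr => i _; rewrite !mxE.
by apply/is_trig_mxP => i k ik; rewrite !mxE up.
Qed.

Section Sphere2.
Variables (z : I01 R -> spin3 R) (a : I01 R -> 'cV[R]_3).
Hypothesis dz : angular (fun t => \val (z t)) a.
Local Notation rot t := (rot3 (\val (z t))).
Let z1 t : dot (\val (z t)) (\val (z t)) = 1 := spin3_unit (z t).

Variable f : I01 R -> 'cV[R]_3.
Hypothesis fE : forall t, f t = rot t ve1.

Lemma cderiv_sphere2 t : cderiv f t = rot t (2 *: cross (a t) ve1).
Proof.
rewrite (_ : f = fun t => rot t ve1); last exact/funext.
rewrite (is_dV_cderiv (is_dV_rot3 dz (is_dV_cst ve1))).
by rewrite add0r.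
Qed.

Lemma spherical_sphere2 : spherical f.
Proof.
move=> t; apply/enorm1P; rewrite fE dot_rot3//; by have [] := @dot_ve R.
Qed.

(** In the frame the derivative is 2 a x e1 = (0, 2 a_3, - 2 a_2); a Frenet frame demands a
    vanishing third coordinate and a positive second one. *)
Lemma frenet_angular t : frenet f t = Pi3 (z t) -> a t 1 0 = 0 /\ 0 < a t 2%:R 0.
Proof.
move=> /frenet_Pi3P[c0 [r [c1 [_ c10 _]]]].
rewrite cderiv_sphere2 -!rot3Z -rot3D => /(rot3_inj (z1 t)).
rewrite (vec3E (a t)) /ve1 /ve2 !vec3_simpl => /vec3_inj[_ e2 e3].
by rewrite !mxE /=; split; lra.
Qed.

(** In the notation of the overview, [al] is p / 2 and [be] is q / 2. *)
Variables (al be be' : I01 R -> R).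
Hypothesis aE : forall t, a t = vec3 (al t) 0 (be t).
Hypothesis be_gt0 : forall t, 0 < be t.
Hypothesis dbe : is_d be be'.

Lemma cderiv_angular t : cderiv f t = (2 * be t) *: rot t ve2.
Proof.
rewrite cderiv_sphere2 -rot3Z aE; congr (rot3 _ _).
by rewrite /ve1 /ve2 !vec3_simpl; congr vec3; ring.
Qed.

Lemma enorm_angular t : enorm (cderiv f t) = 2 * be t.
Proof.
rewrite cderiv_angular /enorm dotZl dotZr dot_rot3//.
have [_ -> _] := @dot_ve R; rewrite mulr1 -expr2 sqrtr_sqr gtr0_norm//.
by rewrite mulr_gt0.
Qed.

Lemma frenet_of_angular t : frenet f t = Pi3 (z t).
Proof.
apply/frenet_Pi3P; exists 1, 0, (2 * be t).
by rewrite ltr01 mulr_gt0// scale1r scale0r add0r cderiv_angular fE.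
Qed.

Lemma generic_angular : generic f.
Proof.
move=> t; have [e11 e22 e12] := @dot_ve R.
have f1 : dot (f t) (f t) = 1 by rewrite fE dot_rot3.
rewrite [jet f t](_ : _ = [:: f t; cderiv f t])// free_cons span_seq1 seq1_free.
apply/andP; split.
  apply/negP => /vlineP[k fk].
  have : dot (f t) (f t) = 0.
    rewrite {2}fk cderiv_angular fE !dotZr dot_rot3// e12.
    by rewrite !mulr0.
  by rewrite f1 => /eqP; rewrite oner_eq0.
apply/eqP => f0; have := enorm_angular t; rewrite f0 /enorm /dot mulmx0 mxE sqrtr0.
have := be_gt0 t; lra.
Qed.

Lemma tangent_angular t : tangent f t = rot t ve2.
Proof.
rewrite /tangent enorm_angular cderiv_angular scalerA mulVf ?scale1r//.
by rewrite gt_eqF// mulr_gt0.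
Qed.

(** The normal is the rotated e3, and the unit tangent moves by 2 a x e2 = (- 2 be, 0, 2 al) in the
    frame; dividing 2 al by the speed 2 be gives the curvature. *)
Lemma geodesic_curvature_angular t : geodesic_curvature f t = al t / be t.
Proof.
have [e11 e22 e12] := @dot_ve R.
rewrite /geodesic_curvature /normal tangent_angular enorm_angular fE.
rewrite -(rot3_ve3 (z1 t)).
have -> : tangent f = fun t => rot t ve2 by apply/funext => s; exact: tangent_angular.
rewrite (is_dV_cderiv (is_dV_rot3 dz (is_dV_cst ve2))) add0r dot_rot3// aE.
rewrite /ve2 /ve3 !vec3_simpl; field.
by rewrite gt_eqF.
Qed.

(** In frame coordinates the derivatives are upper triangular with diagonal 1, 2 be, 4 al be. *)
Lemma locally_convex_angular : (forall t, 0 < al t) -> Defs.locally_convex f.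
Proof.
move=> al0 t.
pose w (k : 'I_3) : 'cV[R]_3 := match val k with
  | 0%N => ve1 | 1%N => (2 * be t) *: ve2
  | _ => (2 * be' t) *: ve2 + 2 *: cross (a t) ((2 * be t) *: ve2) end.
have d2 : cderiv (cderiv f) t = rot t ((2 * be' t) *: ve2 + 2 *: cross (a t) ((2 * be t) *: ve2)).
  have -> : cderiv f = fun t => rot t ((2 * be t) *: ve2).
    by apply/funext => s; rewrite cderiv_angular rot3Z.
  have d2be : is_d (fun t => 2 * be t) (fun t => 2 * be' t).
    apply: is_d_eq; first by apply: is_dM dbe; exact: is_d_cst.
    by apply/funext => s; rewrite mul0r add0r.
  rewrite (is_dV_cderiv (is_dV_rot3 dz (is_dVZ d2be (is_dV_cst ve2)))).
  by rewrite scaler0 addr0.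
have [_ det1] := Pi3_SO (z t).
rewrite (@det_upper 3 w (Pi3 (z t)) (fun k => cderivn k f t)) //; first last.
- move=> [[|[|[|//]]] i] [[|[|[|//]]] k] //= _; rewrite /w /= /ve1 /ve2 ?aE ?vec3_simpl mxE //=.
  by rewrite mulr0.
- move=> [[|[|[|//]]] k]; rewrite mul_Pi3 /w /=.
  + exact: fE.
  + by rewrite rot3Z; exact: cderiv_angular.
  + exact: d2.
rewrite !big_ord_recl big_ord0 /w /= aE /ve1 /ve2 !vec3_simpl !mxE /=.
rewrite mulr1 mul1r mulr_gt0 ?mulr_gt0//.
have := mulr_gt0 (be_gt0 t) (al0 t); nra.
Qed.

End Sphere2.

End SphericalCurves.

(** * Curves on the three-sphere *)

Section Sphere3.
Context {R : realType}.
Variables (z : I01 R -> spin4 R) (a b : I01 R -> 'cV[R]_3).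
Hypothesis dzl : angular (fun t => \val (z t).1) a.
Hypothesis dzr : angular (fun t => \val (z t).2) b.
Local Notation rot t := (rot4 (\val (z t).1) (\val (z t).2)).
Let zl1 t : dot (\val (z t).1) (\val (z t).1) = 1 := spin3_unit (z t).1.
Let zr1 t : dot (\val (z t).2) (\val (z t).2) = 1 := spin3_unit (z t).2.

Variable f : I01 R -> 'cV[R]_3.+1.
Hypothesis fE : forall t, f t = rot t qone.

Lemma spherical_sphere3 : spherical f.
Proof.
move=> t; apply/enorm1P; rewrite fE (dot_rot4 _ _ (zl1 t) (zr1 t)).
by have [[-> _ _] _] := @dot_q R.
Qed.

Lemma cderiv_rot (q q' : I01 R -> 'cV[R]_(1 + 3)) (g : I01 R -> 'cV[R]_3.+1) :
  (forall t, g t = rot t (q t)) -> is_dV q q' -> forall t, cderiv g t =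
  rot t (q' t + qmul (Quat 0 (a t)) (q t) - qmul (q t) (Quat 0 (b t))).
Proof.
move=> gE dq t; have -> : g = fun t => rot t (q t) by apply/funext.
by rewrite (@is_dV_cderiv _ 3 _ _ (is_dV_rot4 dzl dzr dq)).
Qed.

Lemma cderiv_sphere3 t : cderiv f t = rot t (Quat 0 (a t - b t)).
Proof.
rewrite (cderiv_rot fE (is_dV_cst qone)); congr (rot4 _ _ _).
by rewrite qmulq1 qmul1q add0r Quat_opp Quat_add subr0.
Qed.

(** In the frame the first derivative is the imaginary quaternion a - b, which must be a positive
    multiple of i. *)
Lemma frenet_speed t : frenet f t = Pi4 (z t) ->
  [/\ 0 < a t 0 0 - b t 0 0, a t 1 0 = b t 1 0 & a t 2%:R 0 = b t 2%:R 0].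
Proof.
move=> /frenet_Pi4P[c0 [r [c1 [b0 [b1 [c2 [_ [c10 d1] _]]]]]]].
move: d1; rewrite cderiv_sphere3 -!rot4Z -rot4D => /(rot4_inj (zl1 t) (zr1 t)).
rewrite (vec3E (a t)) (vec3E (b t)) !vec3_simpl /qone /qi -/(quat4 _ _ _ _).
by rewrite !quat4_simpl => /quat4_inj[_ e1 e2 e3]; rewrite !mxE /=; split; lra.
Qed.

(** In the notation of the overview, [c] is c1, [be] is c2 / 2 and [a1 + b1] is c3; [m] is the
    common j-component of a and b, shown below to vanish for a Frenet frame. *)
Variables (a1 b1 c c' c'' m be be' : I01 R -> R).
Hypothesis aE : forall t, a t = vec3 (a1 t) (m t) (be t).
Hypothesis bE : forall t, b t = vec3 (b1 t) (m t) (be t).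
Hypothesis cE : forall t, a1 t = b1 t + c t.
Hypothesis dc : is_d c c'.

Lemma cderiv1_speed t : cderiv f t = rot t (quat4 0 (c t) 0 0).
Proof.
rewrite cderiv_sphere3 aE bE cE !vec3_simpl -/(quat4 _ _ _ _); congr rot4.
by congr quat4; ring.
Qed.

Lemma cderiv2_speed t : cderiv (cderiv f) t = rot t (quat4 (- (c t * c t))
  (c' t) (2 * (be t * c t)) (- 2 * (m t * c t))).
Proof.
have d0 := is_d_cst (0 : R).
rewrite (cderiv_rot cderiv1_speed (is_dV_quat4 d0 dc d0 d0)); congr (rot4 _ _ _).
rewrite aE bE cE -!/(quat4 _ _ _ _) !quat4_simpl; congr quat4; ring.
Qed.

(** The second derivative has frame components 2 be c along j and - 2 m c along k; the former must
    be positive and the latter zero. *)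
Lemma frenet_torsion t : frenet f t = Pi4 (z t) -> 0 < c t -> m t = 0 /\ 0 < be t.
Proof.
move=> /frenet_Pi4P[c0 [r [c1 [b0 [b2 [c2 [_ _ [c20 d2]]]]]]]] c_gt0.
move: d2; rewrite cderiv2_speed -!rot4Z -!rot4D => /(rot4_inj (zl1 t) (zr1 t)).
rewrite /qone /qi /qj !quat4_simpl => /quat4_inj[_ _ e2 e3].
have bc : 0 < be t * c t by lra.
split; last by rewrite pmulr_lgt0 in bc.
have /eqP : m t * c t = 0 by lra.
by rewrite mulf_eq0 (gt_eqF c_gt0) orbF => /eqP.
Qed.

Hypothesis m0 : forall t, m t = 0.
Hypothesis dc' : is_d c' c''.
Hypothesis dbe : is_d be be'.

Lemma frenet_of_speed t : 0 < c t -> 0 < be t -> frenet f t = Pi4 (z t).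
Proof.
move=> c0 be0; apply/frenet_Pi4P; exists 1, 0, (c t), (- (c t * c t)), (c' t), (2 * (be t * c t)).
split; split=> //; rewrite ?mulr_gt0//.
- by rewrite scale1r fE.
- rewrite cderiv1_speed -!rot4Z -!rot4D; congr (rot4 _ _ _).
  by rewrite /qone /qi !quat4_simpl; congr quat4; ring.
- rewrite cderiv2_speed m0 -!rot4Z -!rot4D; congr (rot4 _ _ _).
  by rewrite /qone /qi /qj !quat4_simpl; congr quat4; ring.
Qed.

(** Only the k-component is recorded, since the other three lie above the diagonal of the
    determinant. It contains a1 + b1 because i j = k and j i = - k. *)
Lemma cderiv3_speed t : exists x0 x1 x2, cderiv (cderiv (cderiv f)) t =
  rot t (quat4 x0 x1 x2 ((a1 t + b1 t) * (2 * (be t * c t)))).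
Proof.
have d0 := is_d_cst (0 : R).
have d2 : forall t, cderiv (cderiv f) t =
    rot t (quat4 (- (c t * c t)) (c' t) (2 * (be t * c t)) 0).
  by move=> s; rewrite cderiv2_speed m0 mul0r mulr0.
have dq := is_dV_quat4 (is_dN (is_dM dc dc)) dc' (is_dM (is_d_cst 2) (is_dM dbe dc)) d0.
rewrite (cderiv_rot d2 dq) aE bE m0 -!/(quat4 _ _ _ _) !quat4_simpl.
do 3!eexists; congr (rot4 _ _ (quat4 _ _ _ _)); ring.
Qed.

(** The factors are the diagonal entries after the leading 1. Once c and be are positive, the sign
    of the determinant is that of a1 + b1. *)
Lemma det_sphere3 t : \det (\matrix_(i < 4, k < 4) cderivn k f t i 0) =
  c t * (2 * (be t * c t)) * ((a1 t + b1 t) * (2 * (be t * c t))).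
Proof.
have [x0 [x1 [x2 d3]]] := cderiv3_speed t.
pose w (k : 'I_4) : 'cV[R]_4 := match val k with
  | 0%N => qone | 1%N => quat4 0 (c t) 0 0
  | 2%N => quat4 (- (c t * c t)) (c' t) (2 * (be t * c t)) 0
  | _ => quat4 x0 x1 x2 ((a1 t + b1 t) * (2 * (be t * c t))) end.
have [_ det1] := Pi4_SO (z t).
rewrite (@det_upper _ 4 w (Pi4 (z t)) (fun k => cderivn k f t)) //; first last.
- move=> [[|[|[|[|//]]]] i] [[|[|[|[|//]]]] k] //= _; rewrite /w /= /qone;
    exact: quat4_entry.
- move=> [[|[|[|[|//]]]] k]; rewrite mul_Pi4 /w /=.
  + exact: fE.
  + exact: cderiv1_speed.
  + by rewrite -[RHS]/(rot t _) [LHS]cderiv2_speed m0 mul0r mulr0.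
  + exact: d3.
have wE k (i : 'I_(1 + 3)) : w k i 0 = (match val k with
  | 0%N => [:: 1; 0; 0; 0] | 1%N => [:: 0; c t; 0; 0]
  | 2%N => [:: - (c t * c t); c' t; 2 * (be t * c t); 0]
  | _ => [:: x0; x1; x2; (a1 t + b1 t) * (2 * (be t * c t))] end)`_i.
  by rewrite /w; case: k => -[|[|[|[|//]]]] k /=; rewrite ?/qone quat4_entry.
under eq_bigr => i _ do rewrite wE.
by rewrite !big_ord_recl big_ord0 /= mul1r mulr1 !mulrA.
Qed.

End Sphere3.

(** * Smooth dependence of lifts on curves *)

Section Lifts.
Context {R : realType}.

Definition is_lift n (G : topologicalType) (Pi : G -> 'M[R]_n.+1) e
    (f : I01 R -> 'cV[R]_n.+1) (z : I01 R -> G) :=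
  [/\ continuous z, forall t, frenet f t = Pi (z t) & z (I01_start R) = e].

Lemma frenet_lift_endP n (G : topologicalType) (Pi : G -> 'M[R]_n.+1) e
    (f : I01 R -> 'cV[R]_n.+1) w :
  frenet_lift_end Pi e f w <-> exists2 z, is_lift Pi e f z & z (I01_end R) = w.
Proof.
split=> [[z [zc zf z0 z1]]|[z [zc zf z0] z1]].
  by exists z => //; split.
by exists z; split.
Qed.

Lemma mx_of_id n (f : 'cV[R]_n -> 'cV[R]_n) : (forall u, f u = u) -> mx_of f = 1%:M.
Proof.
move=> fi; apply/matrixP => i j; rewrite !mxE fi mxE eqxx andbT //.
Qed.

Lemma val_one3 : \val (one3 R) = qone.
Proof. by rewrite /qone /quat4 -vec3_0. Qed.

Lemma rot4_one q : rot4 qone qone q = q :> 'cV[R]_(1 + 3).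
Proof.
by rewrite /rot4 /qone qconj_quat4 oppr0 -/qone qmul1q qmulq1.
Qed.

Lemma Pi4_one : Pi4 (one4 R) = 1%:M.
Proof. by rewrite Pi4E; apply: mx_of_id => q; rewrite !val_one3 rot4_one. Qed.

Lemma Pi3_one : Pi3 (one3 R) = 1%:M.
Proof.
rewrite Pi3E; apply: mx_of_id => u.
by rewrite val_one3 /rot3 rot4_one Quat_qim.
Qed.

(** The product of z u y^* with the conjugate of z y^* is z u z^*, as y is a unit. The rotation
    covered by the left factor is thus read off the columns of the frame on S^3. *)
Lemma rot3_left (z y : 'cV[R]_(1 + 3)) u : dot y y = 1 ->
  rot3 z u = qim (qmul (rot4 z y (Quat 0 u)) (qconj (rot4 z y qone))).
Proof.
move=> y1; congr qim; rewrite /rot4 qmulq1 qconjM qconjK !qmulA.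
by rewrite -(qmulA _ (qconj y) y) qmul_conjq y1 scale1r qmulq1.
Qed.

Lemma rot3_right (z y : 'cV[R]_(1 + 3)) u : dot z z = 1 ->
  rot3 y u = qim (qmul (qconj (rot4 z y qone)) (rot4 z y (Quat 0 u))).
Proof.
move=> z1; congr qim; rewrite /rot4 qmulq1 qconjM qconjK !qmulA.
by rewrite -(qmulA y (qconj z) z) qmul_conjq z1 scale1r qmulq1.
Qed.

Lemma unit_scale n (u e : 'cV[R]_n) c : 0 < c -> dot u u = 1 -> dot e e = 1 ->
  u = c *: e -> u = e.
Proof.
move=> c0 u1 e1 ue; move: u1; rewrite ue dotZl dotZr e1 mulr1 -expr2 => /eqP.
by rewrite sqrp_eq1 ?ltW// => /eqP ->; rewrite scale1r.
Qed.

Lemma sub_proj1 n (v e0 e1 : 'cV[R]_n) a c : dot e0 e0 = 1 -> dot e0 e1 = 0 ->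
  v = a *: e0 + c *: e1 -> v - dot v e0 *: e0 = c *: e1.
Proof.
move=> e00 e01 ->; rewrite dotDl !dotZl (dotC e1) e00 e01 mulr0 mulr1 addr0.
by rewrite addrAC subrr add0r.
Qed.

Lemma sub_proj2 n (v e0 e1 e2 : 'cV[R]_n) a b c : dot e0 e0 = 1 -> dot e1 e1 = 1 ->
  dot e0 e1 = 0 -> dot e0 e2 = 0 -> dot e1 e2 = 0 ->
  v = a *: e0 + b *: e1 + c *: e2 ->
  v - (dot v e0 *: e0 + dot v e1 *: e1) = c *: e2.
Proof.
move=> e00 e11 e01 e02 e12 ->; rewrite !dotDl !dotZl (dotC e1 e0) (dotC e2 e0) (dotC e2 e1).
rewrite e00 e01 e02 e11 e12 !(mulr0, mulr1, addr0, add0r).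
by rewrite addrAC subrr add0r.
Qed.

Section Families.
Context {T : topologicalType}.

Lemma CsmV_normalize n (w : T -> I01 R -> 'cV[R]_n) :
  (forall x t, 0 < dot (w x t) (w x t)) -> CsmV w -> CsmV (fun x t => normalize (w x t)).
Proof.
move=> w0 sw; apply: (@CsmVZ _ _ _ (fun x t => rsqrt (dot (w x t) (w x t)))) => //.
by apply: Csm_rsqrt => //; exact: Csm_dot.
Qed.

(** The positive factor identifies e with the normalisation of v and keeps v nonzero, so e is as
    smooth as v. *)
Lemma CsmV_gram_schmidt n (v e : T -> I01 R -> 'cV[R]_n) :
  (forall x t, dot (e x t) (e x t) = 1) ->
  (forall x t, exists2 c, 0 < c & v x t = c *: e x t) -> CsmV v -> CsmV e.
Proof.
move=> e1 ve sv.
have <- : (fun x t => normalize (v x t)) = e.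
  by apply/funext => x; apply/funext => t; apply/normalizeP.
apply: CsmV_normalize => // x t; have [k k0 ->] := ve x t.
by rewrite dotZl dotZr e1 mulr1 mulr_gt0.
Qed.

Lemma CsmV_rot4 (z y q : T -> I01 R -> 'cV[R]_(1 + 3)) : CsmV z -> CsmV y -> CsmV q ->
  CsmV (fun x t => rot4 (z x t) (y x t) (q x t)).
Proof.
by move=> sz sy sq; apply: CsmV_qmul; [exact: CsmV_qmul|exact: CsmV_qconj].
Qed.

Lemma CsmV_rot3 (z : T -> I01 R -> 'cV[R]_(1 + 3)) u : CsmV z ->
  CsmV (fun x t => rot3 (z x t) u).
Proof.
by move=> sz; apply: CsmV_qim; apply: CsmV_rot4 => //; exact: CsmV_cst.
Qed.

(** Unit length makes the first frame vector the curve itself, and the second is the normalised part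
    of the derivative orthogonal to it. Both are smooth in the family, so the lift is. *)
Lemma lift3_smooth (g : T -> smooth_curve R 2) (z : T -> I01 R -> spin3 R) :
  continuous g -> (forall x, spherical (g x)) ->
  (forall x, is_lift (@Pi3 R) (one3 R) (g x) (z x)) ->
  (forall x t, g x t = rot3 (\val (z x t)) ve1) /\ CsmV (fun x t => \val (z x t)).
Proof.
move=> /continuous_CsmV sg g1 zg.
have z1 x t := spin3_unit (z x t); have [e11 e22 e12] := @dot_ve R.
have gE x t : g x t = rot3 (\val (z x t)) ve1.
  have [_ /(_ t)/frenet_Pi3P[c0 [a [c1 [c00 _ gE _]]]] _] := zg x.
  by apply: (unit_scale c00 _ _ gE); [by apply/enorm1P; exact: g1|rewrite dot_rot3].
split=> //.
have s1 : CsmV (fun x t => rot3 (\val (z x t)) ve1).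
  by under eq_fun => x do under eq_fun => t do rewrite -gE.
have [sg' _] := CsmV_cderivn 1 sg.
apply: spin3_lift_smooth => [x|x||]; [by have [] := zg x|by have [] := zg x|exact: s1|].
apply: (@CsmV_gram_schmidt _
  (fun x t => cderiv (g x) t - dot (cderiv (g x) t) (g x t) *: g x t)) => [x t|x t|].
- by rewrite dot_rot3.
- have [_ /(_ t)/frenet_Pi3P[c0 [a [c1 [_ c10 _ g'E]]]] _] := zg x.
  exists c1 => //; rewrite gE; apply: sub_proj1 g'E; rewrite dot_rot3 //.
- by apply: (CsmVB sg'); apply: (CsmVZ _ sg); exact: (Csm_dot sg' sg).
Qed.

(** Gram-Schmidt makes the columns of 1, i and j smooth in the family. Multiplying the last two by
    the conjugate of the first, on either side, gives the rotated i and j of each factor, which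
    determine its smooth lift. *)
Lemma lift4_smooth (g : T -> smooth_curve R 3) (z : T -> I01 R -> spin4 R) :
  continuous g -> (forall x, spherical (g x)) ->
  (forall x, is_lift (@Pi4 R) (one4 R) (g x) (z x)) ->
  [/\ forall x t, g x t = rot4 (\val (z x t).1) (\val (z x t).2) qone,
    CsmV (fun x t => \val (z x t).1) & CsmV (fun x t => \val (z x t).2)].
Proof.
move=> /continuous_CsmV sg g1 zg.
have zl1 x t := spin3_unit (z x t).1; have zr1 x t := spin3_unit (z x t).2.
have [[e00 e11 e22] [e01 e02 e12]] := @dot_q R.
pose rot x t := rot4 (\val (z x t).1) (\val (z x t).2).
have d x t p q : dot (rot x t p) (rot x t q) = dot p q by exact: dot_rot4.
have gE x t : g x t = rot x t qone.
  have [_ /(_ t)/frenet_Pi4P[c0 [_ [_ [_ [_ [_ [[c00 gE] _ _]]]]]]] _] := zg x.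
  by apply: (unit_scale c00 _ _ gE); [by apply/enorm1P; exact: g1|rewrite [LHS]d].
have [sg' _] := CsmV_cderivn 1 sg; have [sg'' _] := CsmV_cderivn 2 sg.
have s0 : CsmV (fun x t => rot x t qone).
  by under eq_fun => x do under eq_fun => t do rewrite -gE.
have s1 : CsmV (fun x t => rot x t qi).
  apply: (@CsmV_gram_schmidt _
    (fun x t => cderiv (g x) t - dot (cderiv (g x) t) (rot x t qone) *: rot x t qone))
    => [x t|x t|].
  - by rewrite d.
  - have [_ /(_ t)/frenet_Pi4P[c0 [a [c1 [_ [_ [_ [_ [c10 g'E] _]]]]]]] _] := zg x.
    by exists c1 => //; apply: sub_proj1 g'E; rewrite [LHS]d.
  - by apply: (CsmVB sg'); apply: (CsmVZ _ s0); exact: (Csm_dot sg' s0).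
have s2 : CsmV (fun x t => rot x t qj).
  apply: (@CsmV_gram_schmidt _
    (fun x t => cderiv (cderiv (g x)) t -
       (dot (cderiv (cderiv (g x)) t) (rot x t qone) *: rot x t qone +
        dot (cderiv (cderiv (g x)) t) (rot x t qi) *: rot x t qi)))
    => [x t|x t|].
  - by rewrite d.
  - have [_ /(_ t)/frenet_Pi4P[_ [_ [_ [b0 [b1 [c2 [_ _ [c20 g''E]]]]]]]] _] := zg x.
    by exists c2 => //; apply: sub_proj2 g''E; rewrite [LHS]d.
  - apply: (CsmVB sg''); apply: CsmVD.
      by apply: (CsmVZ _ s0); exact: (Csm_dot sg'' s0).
    by apply: (CsmVZ _ s1); exact: (Csm_dot sg'' s1).
split; first exact: gE.
  apply: spin3_lift_smooth => [x|x||].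
  - have [zc _ _] := zg x; move=> t.
    by apply: continuous_comp; [exact: zc|exact: cvg_fst].
  - by have [_ _ ->] := zg x.
  - under eq_fun => x do under eq_fun => t do rewrite (rot3_left _ _ (zr1 x t)).
    by apply: CsmV_qim; apply: (CsmV_qmul s1); exact: CsmV_qconj s0.
  - under eq_fun => x do under eq_fun => t do rewrite (rot3_left _ _ (zr1 x t)).
    by apply: CsmV_qim; apply: (CsmV_qmul s2); exact: CsmV_qconj s0.
apply: spin3_lift_smooth => [x|x||].
- have [zc _ _] := zg x; move=> t.
  by apply: continuous_comp; [exact: zc|exact: cvg_snd].
- by have [_ _ ->] := zg x.
- under eq_fun => x do under eq_fun => t do rewrite (rot3_right _ _ (zl1 x t)).
  by apply: CsmV_qim; apply: (CsmV_qmul _ s1); exact: CsmV_qconj s0.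
- under eq_fun => x do under eq_fun => t do rewrite (rot3_right _ _ (zl1 x t)).
  by apply: CsmV_qim; apply: (CsmV_qmul _ s2); exact: CsmV_qconj s0.
Qed.

End Families.
End Lifts.

(** * The correspondence *)

Section Correspondence.
Context {R : realType} {T : topologicalType}.

Section FromS3.
Variables (g : T -> smooth_curve R 3) (z : T -> I01 R -> spin4 R).
Hypothesis gc : continuous g.
Hypothesis g1 : forall x, spherical (g x).
Hypothesis glc : forall x, Defs.locally_convex (g x).
Hypothesis zg : forall x, is_lift (@Pi4 R) (one4 R) (g x) (z x).

Lemma S3_to_S2 x (cl cr : smooth_curve R 2) :
  (forall t, cl t = rot3 (\val (z x t).1) ve1) ->
  (forall t, cr t = rot3 (\val (z x t).2) ve1) ->
  [/\ spherical cl, Defs.locally_convex cl &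
    is_lift (@Pi3 R) (one3 R) cl (fun t => (z x t).1)] /\
  [/\ spherical cr, generic cr & is_lift (@Pi3 R) (one3 R) cr (fun t => (z x t).2)] /\
  forall t, enorm (cderiv cl t) = enorm (cderiv cr t) /\
    `|geodesic_curvature cr t| < geodesic_curvature cl t.
Proof.
move=> clE crE.
have [gE sl sr] := lift4_smooth gc g1 zg.
have [a sa da] := angular_velocity sl (fun x t => spin3_unit (z x t).1).
have [b sb db] := angular_velocity sr (fun x t => spin3_unit (z x t).2).
have [zc zf z0] := zg x.
have sp t := frenet_speed (da x) (db x) (gE x) (zf t).
have sc : Csm (fun x t => a x t 0 0 - b x t 0 0) by apply: CsmD (sa 0) _; exact: CsmN (sb 0).
have [c' dc sc'] := Csm_d sc; have [c'' dc' _] := Csm_d sc'.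
have [be' dbe _] := Csm_d (sa 2%:R).
have aE t : a x t = vec3 (a x t 0 0) (a x t 1 0) (a x t 2%:R 0) by exact: vec3E.
(* By [frenet_speed] the j- and k-components of b are those of a. *)
have bE t : b x t = vec3 (b x t 0 0) (a x t 1 0) (a x t 2%:R 0).
  by have [_ -> ->] := sp t; exact: vec3E.
have cE t : a x t 0 0 = b x t 0 0 + (a x t 0 0 - b x t 0 0) by rewrite addrC subrK.
have tors t := frenet_torsion (da x) (db x) (gE x) aE bE cE (dc x) (zf t).
have c0 t : 0 < a x t 0 0 - b x t 0 0 by have [] := sp t.
have m0 t : a x t 1 0 = 0 by have [] := tors t (c0 t).
have be0 t : 0 < a x t 2%:R 0 by have [] := tors t (c0 t).
(* In the positive determinant every factor other than a1 + b1 is already known to be positive. *)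
have sum0 t : 0 < a x t 0 0 + b x t 0 0.
  have := glc x t; rewrite (det_sphere3 (da x) (db x) (gE x) aE bE cE (dc x) m0 (dc' x) (dbe x)).
  by rewrite pmulr_rgt0 ?pmulr_lgt0 ?mulr_gt0 ?c0 ?be0.
have aE0 t : a x t = vec3 (a x t 0 0) 0 (a x t 2%:R 0) by rewrite -(m0 t).
have bE0 t : b x t = vec3 (b x t 0 0) 0 (a x t 2%:R 0) by rewrite [LHS]bE m0.
have a0 t : 0 < a x t 0 0 by have := c0 t; have := sum0 t; lra.
split; [|split].
- split; [exact: spherical_sphere2 clE| |].
    exact: (locally_convex_angular (da x) clE aE0 be0 (dbe x) a0).
  split; [|by move=> t; exact: (frenet_of_angular (da x) clE aE0 be0)|by rewrite z0].
  by move=> t; apply: continuous_comp; [exact: zc|exact: cvg_fst].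
- split; [exact: spherical_sphere2 crE|exact: (generic_angular (db x) crE bE0 be0)|].
  split; [|by move=> t; exact: (frenet_of_angular (db x) crE bE0 be0)|by rewrite z0].
  by move=> t; apply: continuous_comp; [exact: zc|exact: cvg_snd].
- move=> t; rewrite (enorm_angular (da x) clE aE0 be0) (enorm_angular (db x) crE bE0 be0).
  split=> //.
  rewrite (geodesic_curvature_angular (da x) clE aE0 be0).
  rewrite (geodesic_curvature_angular (db x) crE bE0 be0).
  rewrite normrM (gtr0_norm (_ : 0 < _^-1)) ?invr_gt0// ltr_pM2r ?invr_gt0//.
  (* Positivity of a1 - b1 and of a1 + b1 is the inequality |b1| < a1 between the numerators of the
     curvatures. *)
  by have := c0 t; have := sum0 t; rewrite ltr_norml => ? ?; apply/andP; split; lra.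
Qed.

End FromS3.

Section FromS2.
Variables (gl gr : T -> smooth_curve R 2) (zl zr : T -> I01 R -> spin3 R).
Hypothesis glc : continuous gl.
Hypothesis grc : continuous gr.
Hypothesis gl1 : forall x, spherical (gl x).
Hypothesis gr1 : forall x, spherical (gr x).
Hypothesis zgl : forall x, is_lift (@Pi3 R) (one3 R) (gl x) (zl x).
Hypothesis zgr : forall x, is_lift (@Pi3 R) (one3 R) (gr x) (zr x).
Hypothesis speed : forall x t, enorm (cderiv (gl x) t) = enorm (cderiv (gr x) t).
Hypothesis curv : forall x t,
  `|geodesic_curvature (gr x) t| < geodesic_curvature (gl x) t.

Lemma S2_to_S3 x (c : smooth_curve R 3) :
  (forall t, c t = rot4 (\val (zl x t)) (\val (zr x t)) qone) ->
  [/\ spherical c, Defs.locally_convex c &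
    is_lift (@Pi4 R) (one4 R) c (fun t => (zl x t, zr x t))].
Proof.
move=> cE; pose z t : spin4 R := (zl x t, zr x t).
have [glE sl] := lift3_smooth glc gl1 zgl; have [grE sr] := lift3_smooth grc gr1 zgr.
have [a sa da] := angular_velocity sl (fun x t => spin3_unit (zl x t)).
have [b sb db] := angular_velocity sr (fun x t => spin3_unit (zr x t)).
have [zlc zlf zl0] := zgl x; have [zrc zrf zr0] := zgr x.
have fa t := frenet_angular (da x) (glE x) (zlf t).
have fb t := frenet_angular (db x) (grE x) (zrf t).
have a30 t : 0 < a x t 2%:R 0 by have [] := fa t.
have b30 t : 0 < b x t 2%:R 0 by have [] := fb t.
have aE t : a x t = vec3 (a x t 0 0) 0 (a x t 2%:R 0).
  by have [<- _] := fa t; exact: vec3E.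
have bE t : b x t = vec3 (b x t 0 0) 0 (b x t 2%:R 0).
  by have [<- _] := fb t; exact: vec3E.
(* Each speed is twice the k-component of the angular velocity, so equal speeds equate these
   components. *)
have ab3 t : b x t 2%:R 0 = a x t 2%:R 0.
  have := speed x t; rewrite (enorm_angular (da x) (glE x) aE a30).
  rewrite (enorm_angular (db x) (grE x) bE b30); lra.
(* Both curvatures now have the same positive denominator and are compared by their numerators. *)
have lt t : `|b x t 0 0| < a x t 0 0.
  have := curv x t; rewrite (geodesic_curvature_angular (da x) (glE x) aE a30).
  rewrite (geodesic_curvature_angular (db x) (grE x) bE b30) ab3.
  by rewrite normrM (gtr0_norm (_ : 0 < _^-1)) ?invr_gt0// ltr_pM2r ?invr_gt0.
have sc : Csm (fun x t => a x t 0 0 - b x t 0 0) by apply: CsmD (sa 0) _; exact: CsmN (sb 0).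
have [c' dc sc'] := Csm_d sc; have [c'' dc' _] := Csm_d sc'.
have [be' dbe _] := Csm_d (sa 2%:R).
have bE' t : b x t = vec3 (b x t 0 0) 0 (a x t 2%:R 0) by rewrite -ab3.
have cE' t : a x t 0 0 = b x t 0 0 + (a x t 0 0 - b x t 0 0) by rewrite addrC subrK.
have c0 t : 0 < a x t 0 0 - b x t 0 0.
  by have := lt t; rewrite ltr_norml => /andP[]; lra.
have s0 t : 0 < a x t 0 0 + b x t 0 0.
  by have := lt t; rewrite ltr_norml => /andP[]; lra.
have da' : angular (fun t => \val (z t).1) (a x) by exact: da.
have db' : angular (fun t => \val (z t).2) (b x) by exact: db.
(* The common j-component [m] of the computation on S^3 is here the constant 0. *)
have m0 (t : I01 R) : 0 = 0 :> R by [].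
split.
- exact: (@spherical_sphere3 _ z).
- move=> t; rewrite (det_sphere3 da' db' cE aE bE' cE' (dc x) m0 (dc' x) (dbe x)).
  by rewrite !mulr_gt0 ?c0 ?a30 ?s0.
- split; last by rewrite zl0 zr0.
    exact: (continuous_pair zlc zrc).
  by move=> t; rewrite (frenet_of_speed da' db' cE aE bE' cE' (dc x) m0 (c0 t) (a30 t)).
Qed.

End FromS2.

Lemma lift4_smooth_rot3 (g : T -> smooth_curve R 3) (z : T -> I01 R -> spin4 R) :
  continuous g -> (forall x, spherical (g x)) ->
  (forall x, is_lift (@Pi4 R) (one4 R) (g x) (z x)) ->
  CsmV (fun x t => rot3 (\val (z x t).1) ve1) /\
  CsmV (fun x t => rot3 (\val (z x t).2) ve1).
Proof.
by move=> gc g1 zg; have [_ sl sr] := lift4_smooth gc g1 zg; split; exact: CsmV_rot3.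
Qed.

End Correspondence.

Lemma smooth_curve_eq (R : realType) n (c d : smooth_curve R n) :
  (forall t, c t = d t) -> c = d.
Proof.
case: c d => [f fs] [h hs] /= e; have fh : f = h by apply/funext.
by rewrite fh in fs *; congr SmoothCurve; exact: Prop_irrelevance.
Qed.

Lemma Pi4_rot4 (R : realType) (z y : spin4 R) : Pi4 z = Pi4 y ->
  forall q, rot4 (\val z.1) (\val z.2) q = rot4 (\val y.1) (\val y.2) q.
Proof. by move=> zy q; rewrite -!mul_Pi4 zy. Qed.

(** A matrix in SO(4) determines the pair of factors up to a common sign, which the rotations u -> z
    u z^* do not see. *)
Lemma Pi4_rot3 (R : realType) (z y : spin4 R) : Pi4 z = Pi4 y ->
  forall u, rot3 (\val z.1) u = rot3 (\val y.1) u /\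
    rot3 (\val z.2) u = rot3 (\val y.2) u.
Proof.
move=> zy u; have r := Pi4_rot4 zy; split.
  by rewrite (rot3_left _ _ (spin3_unit z.2)) !r -rot3_left// spin3_unit.
by rewrite (rot3_right _ _ (spin3_unit z.1)) !r -rot3_right// spin3_unit.
Qed.

Lemma lift3_unique (R : realType) (f : I01 R -> 'cV[R]_3) (z y : I01 R -> spin3 R) :
  is_lift (@Pi3 R) (one3 R) f z -> is_lift (@Pi3 R) (one3 R) f y -> z = y.
Proof.
move=> [zc zf z0] [yc yf y0].
apply: spin3_lift_unique => // [|t|t]; first by rewrite z0.
  by rewrite -!mul_Pi3 -zf -yf.
by rewrite -!mul_Pi3 -zf -yf.
Qed.

Theorem theorem4 (R : realType) (zl zr : spin3 R) :
  homeomorphic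
    (LS3 (zl, zr))
    [set c : smooth_curve R 2 * smooth_curve R 2 |
      [/\ LS2 zl c.1, GS2 zr c.2
        & forall t : I01 R,
            enorm (cderiv c.1 t) = enorm (cderiv c.2 t) /\
            `|geodesic_curvature c.2 t| < geodesic_curvature c.1 t]].
Proof.
set X := LS3 _; set Y := [set c | _].
have vX (x : X) : LS3 (zl, zr) (\val x) by have := valP x; rewrite inE.
have vY (y : Y) : Y (\val y) by have := valP y; rewrite inE.
have Xc : continuous (\val : X -> _) by exact: initial_continuous.
have Yc : continuous (\val : Y -> _) by exact: initial_continuous.
have X1 (x : X) : spherical (\val x) by have [] := vX x.
have Xlc (x : X) : Defs.locally_convex (\val x) by have [] := vX x.
(* Lifts are picked curve by curve; their regularity in x is recovered afterwards from the
   frames. *)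
have /choice[z zP] (x : X) : exists z, is_lift (@Pi4 R) (one4 R) (\val x) z /\
    z (I01_end R) = (zl, zr).
  by have [_ _ _ /frenet_lift_endP[z]] := vX x; exists z.
have zX x := (zP x).1.
have Ylc : continuous (fun y : Y => (\val y).1).
  by move=> y; apply: continuous_comp; [exact: Yc|exact: cvg_fst].
have Yrc : continuous (fun y : Y => (\val y).2).
  by move=> y; apply: continuous_comp; [exact: Yc|exact: cvg_snd].
have Yl1 (y : Y) : spherical (\val y).1 by have [[]] := vY y.
have Yr1 (y : Y) : spherical (\val y).2 by have [_ []] := vY y.
have Ys (y : Y) t : enorm (cderiv (\val y).1 t) = enorm (cderiv (\val y).2 t).
  by have [_ _ /(_ t)[]] := vY y.
have Yk (y : Y) t : `|geodesic_curvature (\val y).2 t| < geodesic_curvature (\val y).1 t.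
  by have [_ _ /(_ t)[]] := vY y.
have /choice[wl wlP] (y : Y) : exists w, is_lift (@Pi3 R) (one3 R) (\val y).1 w /\
    w (I01_end R) = zl.
  by have [[_ _ _ /frenet_lift_endP[w]]] := vY y; exists w.
have /choice[wr wrP] (y : Y) : exists w, is_lift (@Pi3 R) (one3 R) (\val y).2 w /\
    w (I01_end R) = zr.
  by have [_ [_ _ _ /frenet_lift_endP[w]]] := vY y; exists w.
have wlY y := (wlP y).1; have wrY y := (wrP y).1.
(* The parameter space is X itself, carrying its tautological family of curves; likewise Y for the
   inverse map. *)
have [sl sr] := lift4_smooth_rot3 Xc X1 zX.
have [wlE swl] := lift3_smooth Ylc Yl1 wlY; have [wrE swr] := lift3_smooth Yrc Yr1 wrY.
have sg : CsmV (fun (y : Y) t => rot4 (\val (wl y t)) (\val (wr y t)) qone).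
  by apply: CsmV_rot4 => //; exact: CsmV_cst.
pose phi_l : X -> smooth_curve R 2 := curve_family sl.
pose phi_r : X -> smooth_curve R 2 := curve_family sr.
pose psi : Y -> smooth_curve R 3 := @curve_family _ _ 3 _ sg.
have phi_lE x t : phi_l x t = rot3 (\val (z x t).1) ve1 by [].
have phi_rE x t : phi_r x t = rot3 (\val (z x t).2) ve1 by [].
have psiE y t : psi y t = rot4 (\val (wl y t)) (\val (wr y t)) qone by [].
have phi_spec x := S3_to_S2 Xc X1 Xlc zX (phi_lE x) (phi_rE x).
have psi_spec y := S2_to_S3 Ylc Yrc Yl1 Yr1 wlY wrY Ys Yk (psiE y).
have phiP (x : X) : (phi_l x, phi_r x) \in Y.
  rewrite inE.
  have [[cl1 clc cll] [[cr1 crg crl] cc]] := phi_spec x.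
  split; [split; [exact: cl1|exact: clc| |]|split; [exact: cr1|exact: crg| |]|exact: cc].
  - by have [_ -> ->] := cll; exact: Pi3_one.
  - by apply/frenet_lift_endP; exists (fun t => (z x t).1); [exact: cll|rewrite (zP x).2].
  - by have [_ -> ->] := crl; exact: Pi3_one.
  - by apply/frenet_lift_endP; exists (fun t => (z x t).2); [exact: crl|rewrite (zP x).2].
have psiP (y : Y) : psi y \in X.
  have [p1 plc plift] := psi_spec y.
  rewrite inE; split=> //.
    by have [_ -> ->] := plift; exact: Pi4_one.
  apply/frenet_lift_endP; exists (fun t => (wl y t, wr y t)) => //.
  by rewrite (wlP y).2 (wrP y).2.
exists (fun x => SigSub (phiP x)), (fun y => SigSub (psiP y)); split.
- apply: continuous_comp_initial.
  by apply: continuous_pair; [exact: (CsmV_continuous (c := phi_l) sl)|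
    exact: (CsmV_continuous (c := phi_r) sr)].
- by apply: continuous_comp_initial; exact: (CsmV_continuous (c := psi) sg).
- move=> x; apply: val_inj; apply: smooth_curve_eq => t.
  have [[_ _ cll] [[_ _ crl] _]] := phi_spec x.
  pose y : Y := SigSub (phiP x).
  (* The lift picked for the left curve of the image pair is the left factor of the lift of x, signs
     included; similarly on the right. Hence zl zr^* is the original curve. *)
  have wlz : wl y = fun t => (z x t).1 := lift3_unique (wlY y) cll.
  have wrz : wr y = fun t => (z x t).2 := lift3_unique (wrY y) crl.
  rewrite psiE -/y wlz wrz.
  by have [xE _ _] := lift4_smooth Xc X1 zX; rewrite xE.
- move=> y; apply: val_inj; rewrite [RHS]surjective_pairing /=.
  have [_ _ [_ wf _]] := psi_spec y.
  (* The lift picked for the new curve on S^3 and the pair of lifts on S^2 are compared through the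
     frame they both cover, which already determines zl i zl^* and zr i zr^*. *)
  have zw t : Pi4 (z (SigSub (psiP y)) t) = Pi4 (wl y t, wr y t).
    by have [_ zf _] := zX (SigSub (psiP y)); rewrite -wf -zf.
  congr (_, _); apply: smooth_curve_eq => t; have [rl rr] := Pi4_rot3 (zw t) ve1.
    by rewrite phi_lE rl wlE.
  by rewrite phi_rE rr wrE.
Qed.
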